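(* Fix a centrally symmetric polygon $Q$ with up/down indices and let $\Theta^B_f$ be the lattice congruence of the weak order on $B_n$ whose classes are the fibers of the map $\eta^B$ described below. Let $\vec G^B_f$ be the orientation of the Coxeter diagram $s_0 \overset{4}{-} s_1 - s_2 - \cdots - s_{n-1}$ of $B_n$ given by $s_b\to s_{b-1}$ for every up index $b\in[n-1]$ and $s_{b-1}\to s_b$ for every down index $b\in[n-1]$. Then the quotient lattice $B_n/\Theta^B_f$ is the Cambrian lattice $\mathcal C(\vec G^B_f)$ (i.e. $\Theta^B_f=\Theta(\vec G^B_f)$).
   Context: $B_n$: signed permutations of $\pm[n]$ ($x(-i)=-x(i)$), full notation $x_{-n},\dots,x_{-1},x_1,\dots,x_n$; generators $s_0=(-1\ 1)$, $s_i=(i\ i{+}1)(-i{-}1\ {-i})$, $i\in[n-1]$, with $m(s_0,s_1)=4$, $m(s_i,s_{i+1})=3$. Weak order: $v\le w$ iff $I(v)\subseteq I(w)$, $I(w)$ the reflections $t$ with $\ell(tw)<\ell(w)$. The Cambrian congruence $\Theta(\vec G)$ is the smallest lattice congruence of the weak order such that for each directed edge $s\to t$, $t$ is congruent to the element with word $tsts\cdots$ of $m(s,t)-1$ letters; $\mathcal C(\vec G)$ is the quotient. $Q$: convex $(2n+2)$-gon with vertices $v_i$, $i\in\{\pm1,\dots,\pm(n+1)\}$, $v_{-i}=-v_i$, $x$-coordinates strictly increasing in the order $-n-1<\dots<-1<1<\dots<n+1$, $v_{\pm(n+1)}$ on the $x$-axis; $i$ is up if $v_i$ lies above the axis, down otherwise.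 For $x\in B_n$ with full notation $y_1,\dots,y_{2n}$, paths $\lambda_0,\dots,\lambda_{2n}$ from $v_{-n-1}$ to $v_{n+1}$ visit vertices in increasing index: $\lambda_0$ visits $v_{-n-1}$, all down vertices, $v_{n+1}$; $\lambda_k$ is $\lambda_{k-1}$ with $v_{y_k}$ deleted if $y_k$ down, added if $y_k$ up. $\eta^B(x)$ is the set of diagonals of $Q$ that are edges of some $\lambda_k$. *)

(* Defs.v *)
From HB Require Import structures.
From mathcomp Require Import all_boot all_order all_algebra all_fingroup.
Set Implicit Arguments. Unset Strict Implicit. Unset Printing Implicit Defensive.
Import GRing.Theory Num.Theory.

(* The element (false, i) of sgn n encodes  i+1, (true, i) encodes  *)
(* -(i+1), for i : 'I_n.                                            *)
Definition sgn (n : nat) := (bool * 'I_n)%type.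
Definition negT n (a : sgn n) : sgn n := (~~ a.1, a.2).

Definition signed n (x : {perm sgn n}) : Prop :=
  forall a : sgn n, x (negT a) = negT (x a).

(* functional composition  f o g  (mathcomp's  g * f  applies g first) *)
Definition comp n (f g : {perm sgn n}) : {perm sgn n} := (g * f)%g.

Definition predo n (i : 'I_n) : 'I_n := insubd i i.-1.

(* generators: gen 0 = s_0 = (-1 1);
   gen i = s_i = (i i+1)(-i-1 -i) for 1 <= i <= n-1 *)
Definition gen n (i : 'I_n) : {perm sgn n} :=
  if val i == 0 then tperm (false, i) (true, i)
  else (tperm (false, predo i) (false, i) * tperm (true, predo i) (true, i))%g.

Definition wprod n (s : seq 'I_n) : {perm sgn n} :=
  foldr (fun i acc => comp (gen i) acc) 1%g s.

Definition haslen n (w : {perm sgn n}) (k : nat) : Prop :=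
  (exists s : seq 'I_n, size s = k /\ wprod s = w) /\
  (forall s : seq 'I_n, wprod s = w -> k <= size s).

Definition reflection n (t : {perm sgn n}) : Prop :=
  exists (w : {perm sgn n}) (i : 'I_n), signed w /\ t = (w * gen i * w^-1)%g.

Definition inv_set n (w t : {perm sgn n}) : Prop :=
  reflection t /\
  exists k1 k2, haslen (comp t w) k1 /\ haslen w k2 /\ k1 < k2.

Definition wle n (v w : {perm sgn n}) : Prop :=
  forall t, inv_set v t -> inv_set w t.

Definition is_join n (a b j : {perm sgn n}) : Prop :=
  signed j /\ wle a j /\ wle b j /\
  forall k, signed k -> wle a k -> wle b k -> wle j k.

Definition is_meet n (a b m : {perm sgn n}) : Prop :=
  signed m /\ wle m a /\ wle m b /\
  forall k, signed k -> wle k a -> wle k b -> wle k m.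

Definition lat_cong n (R : {perm sgn n} -> {perm sgn n} -> Prop) : Prop :=
  (forall x y, R x y -> signed x /\ signed y) /\
  (forall x, signed x -> R x x) /\
  (forall x y, R x y -> R y x) /\
  (forall x y z, R x y -> R y z -> R x z) /\
  (forall x y z j1 j2, signed z -> R x y ->
      is_join x z j1 -> is_join y z j2 -> R j1 j2) /\
  (forall x y z m1 m2, signed z -> R x y ->
      is_meet x z m1 -> is_meet y z m2 -> R m1 m2).

(* up b : index b in [n] is up (then -b is down).                   *)
Definition arrow n (up : nat -> bool) (s t : 'I_n) : Prop :=
  exists b : nat, 0 < b < n /\
    ((up b /\ val s = b /\ val t = b.-1) \/
     (~~ up b /\ val s = b.-1 /\ val t = b)).

(* Coxeter matrix entry m(s,t) for adjacent generators *)
Definition mst n (s t : 'I_n) : nat :=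
  if (val s == 0) || (val t == 0) then 4 else 3.

Definition altword n (t s : 'I_n) (k : nat) : seq 'I_n :=
  mkseq (fun i => if odd i then s else t) k.

Definition camb_cong n (up : nat -> bool) (x y : {perm sgn n}) : Prop :=
  forall R : {perm sgn n} -> {perm sgn n} -> Prop,
    lat_cong R ->
    (forall s t, arrow up s t -> R (gen t) (wprod (altword t s (mst s t).-1))) ->
    R x y.

(* Vertex (false, i) is v_{i+1}, (true, i) is v_{-(i+1)}, i : 'I_n.+1 *)
Definition vtx (n : nat) := (bool * 'I_n.+1)%type.

Definition vval n (v : vtx n) : int :=
  if v.1 then (- Posz (val v.2).+1)%R else Posz (val v.2).+1.

Definition upV n (up : nat -> bool) (v : vtx n) : bool :=
  (val v.2 < n) && (if v.1 then ~~ up (val v.2).+1 else up (val v.2).+1).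

Definition downV n (up : nat -> bool) (v : vtx n) : bool :=
  (val v.2 < n) && ~~ upV up v.

(* edges of a path through the vertex set L (visited in increasing index) *)
Definition pedges n (L : {set vtx n}) : {set vtx n * vtx n} :=
  [set p | [&& p.1 \in L, p.2 \in L, (vval p.1 < vval p.2)%R &
     [forall c, (c \in L) ==> ~~ ((vval p.1 < vval c)%R && (vval c < vval p.2)%R)]]].

(* upper and lower boundary chains of Q *)
Definition upper n (up : nat -> bool) : {set vtx n} :=
  [set v | (val v.2 == n) || upV up v].
Definition lower n (up : nat -> bool) : {set vtx n} :=
  [set v | (val v.2 == n) || downV up v].

Definition isdiag n (up : nat -> bool) (p : vtx n * vtx n) : bool :=
  [&& (vval p.1 < vval p.2)%R, p \notin pedges (upper n up) &
      p \notin pedges (lower n up)].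

Definition tv n (a : sgn n) : vtx n := (a.1, widen_ord (leqnSn n) a.2).

Definition fullnot n (x : {perm sgn n}) : seq (sgn n) :=
  [seq x (true, i) | i <- rev (enum 'I_n)] ++ [seq x (false, i) | i <- enum 'I_n].

Definition step n (up : nat -> bool) (L : {set vtx n}) (a : sgn n) : {set vtx n} :=
  if upV up (tv a) then tv a |: L else L :\ tv a.

Definition lambdas n (up : nat -> bool) (x : {perm sgn n}) : seq {set vtx n} :=
  lower n up :: scanl (step up) (lower n up) (fullnot x).

Definition etaB n (up : nat -> bool) (x : {perm sgn n}) : {set vtx n * vtx n} :=
  [set p | isdiag up p && has (fun L => p \in pedges L) (lambdas up x)].

(* Main.v *)
(** Record a signed permutation by the relative order in which the values stand in its full
    notation.  The weak order is then inclusion of inversion sets, and a cover swaps an adjacent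
    pair [a < c] together with its mirror image.  Such a cover stays inside a fiber of [etaB]
    exactly when some value [b] with [a < b < c] is present on the path while [a] and [c] are
    processed, i.e. [b] is up and stands before them, or is down and stands after them.

    The fibers are the classes generated by these contracted covers.  A class is determined by the
    non-contracted join-irreducibles [T] below its members, which makes it compatible with meets;
    reversing the full notation and exchanging up with down gives joins.  The Cambrian generators
    are products of contracted covers, so the Cambrian congruence is contained in the fiber
    relation.

    Conversely, let [R] be a congruence containing the generators; every contracted cover is shown
    to lie in [R] by induction on the distance from [a] to [c].  Whether a cover lies in [R] depends
    only on [a], [c] and on which intermediate values stand before them, so another intermediate
    value [e] can be moved next to the pair.  In the hexagon or octagon so obtained the cover is a
    side edge, and one of the two bottom edges is contracted with a smaller distance.  When no [e]
    is left, the cover is forced by a generator. *)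
Require Import Defs.
From mathcomp Require Import all_boot all_order all_algebra all_fingroup.
From mathcomp Require Import zify.
Set Implicit Arguments. Unset Strict Implicit. Unset Printing Implicit Defensive.

(** * Signed permutations as orders *)

(* Rank, from 0 to 2n-1, in the order -n < ... < -1 < 1 < ... < n. *)
Definition key n (a : sgn n) : nat := if a.1 then n.-1 - a.2 else n + a.2.

Lemma key_lt n (a : sgn n) : key a < n.*2.
Proof. by case: a => [[] i]; rewrite /key /=; have := ltn_ord i; lia. Qed.

Lemma key_neg n (a : sgn n) : key (negT a) + key a + 1 = n.*2.
Proof. by case: a => [[] i]; rewrite /key /=; have := ltn_ord i; lia. Qed.

Lemma key_inj n : injective (@key n).
Proof.
move=> [[] i] [[] j]; rewrite /key /=; have := ltn_ord i; have := ltn_ord j => Hj Hi H;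
  try lia; congr pair; apply: val_inj => /=; lia.
Qed.

Lemma key_surj n k : k < n.*2 -> exists a : sgn n, key a = k.
Proof.
move=> lt_k; case: (ltnP k n) => Hk.
  have H : n.-1 - k < n by lia.
  by exists (true, Ordinal H); rewrite /key /=; lia.
have H : k - n < n by lia.
by exists (false, Ordinal H); rewrite /key /=; lia.
Qed.

Lemma negTK n : involutive (@negT n).
Proof. by case=> s i; rewrite /negT /= negbK. Qed.

Lemma eq_key n (a b : sgn n) : (a == b) = (key a == key b).
Proof. by rewrite (inj_eq (@key_inj n)). Qed.

(* [pos x u] is the index at which the value [u] stands in the full notation of [x]. *)
Definition pos n (x : {perm sgn n}) (u : sgn n) : nat := key (x^-1 u)%g.

Lemma pos_lt n (x : {perm sgn n}) u : pos x u < n.*2.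
Proof. exact: key_lt. Qed.

Lemma pos_inj n (x : {perm sgn n}) : injective (pos x).
Proof. by move=> u v /key_inj /perm_inj. Qed.

Lemma eq_pos n (x : {perm sgn n}) u v : (u == v) = (pos x u == pos x v).
Proof. by rewrite (inj_eq (@pos_inj n x)). Qed.

Lemma pos_surj n (x : {perm sgn n}) k : k < n.*2 -> exists u, pos x u = k.
Proof.
by case/key_surj=> a <-; exists (x a); rewrite /pos permK.
Qed.

Lemma signedV n (x : {perm sgn n}) : signed x -> signed (x^-1)%g.
Proof. by move=> sx a; apply: (@perm_inj _ x); rewrite sx !permKV. Qed.

Lemma signedM n (x y : {perm sgn n}) : signed x -> signed y -> signed (x * y)%g.
Proof. by move=> sx sy a; rewrite !permM sx sy. Qed.

Lemma signed1 n : signed (1%g : {perm sgn n}).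
Proof. by move=> a; rewrite !perm1. Qed.

Lemma pos_neg n (x : {perm sgn n}) u : signed x -> pos x (negT u) + pos x u + 1 = n.*2.
Proof. by move=> sx; rewrite /pos signedV // key_neg. Qed.

Definition inv n (x : {perm sgn n}) (u v : sgn n) : bool :=
  (key u < key v) && (pos x v < pos x u).

Definition le n (x y : {perm sgn n}) : Prop := forall u v, inv x u v -> inv y u v.

Lemma le_refl n (x : {perm sgn n}) : le x x. Proof. by []. Qed.

Lemma le_trans n (y x z : {perm sgn n}) : le x y -> le y z -> le x z.
Proof. by move=> xy yz u v /xy /yz. Qed.

Lemma inv_neg n (x : {perm sgn n}) u v : signed x -> inv x (negT v) (negT u) = inv x u v.
Proof.
move=> sx; rewrite /inv.
have := key_neg u; have := key_neg v; have := pos_neg u sx; have := pos_neg v sx; lia.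
Qed.

Lemma inv_trans n (x : {perm sgn n}) u v w : inv x u v -> inv x v w -> inv x u w.
Proof. rewrite /inv; lia. Qed.

Lemma inv_cotrans n (x : {perm sgn n}) u v w :
  key u < key v -> key v < key w -> inv x u w -> inv x u v || inv x v w.
Proof. rewrite /inv; lia. Qed.

Lemma inv_lt n (x : {perm sgn n}) u v : inv x u v -> key u < key v.
Proof. by case/andP. Qed.

Lemma inv_pos n (x : {perm sgn n}) u v : inv x u v -> pos x v < pos x u.
Proof. by case/andP. Qed.

Lemma card_lt_pos n (x : {perm sgn n}) u : #|[set w | pos x w < pos x u]| = pos x u.
Proof.
have -> : [set w | pos x w < pos x u] =
    [set x a | a in [set a : sgn n | key a < pos x u]].
  apply/setP=> w; rewrite !inE; apply/idP/imsetP => [H|[a]].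
    by exists (x^-1 w)%g; rewrite ?inE // permKV.
  by rewrite inE => H ->; rewrite /pos permK.
rewrite card_imset; last exact: perm_inj.
have := pos_lt x u; move: (pos x u) => k.
elim: k => [|k IH] Hk; first by apply/eqP; rewrite cards_eq0 -subset0; apply/subsetP=> a; rewrite inE.
have [a Ha] := key_surj (ltnW Hk).
have -> : [set b : sgn n | key b < k.+1] = a |: [set b : sgn n | key b < k].
  apply/setP=> b; rewrite !inE eq_key. rewrite Ha ltnS leq_eqVlt //.
rewrite cardsU1 IH; last exact: ltnW.
by rewrite inE Ha ltnn.
Qed.

Lemma perm_pos_inj n (x y : {perm sgn n}) : pos x =1 pos y -> x = y.
Proof.
move=> H; apply: invg_inj; apply/permP=> u; apply: key_inj; exact: H.
Qed.

Lemma pos_eq_bef n (x y : {perm sgn n}) :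
  (forall u v, (pos x u < pos x v) = (pos y u < pos y v)) -> x = y.
Proof.
move=> H; apply: perm_pos_inj => u; rewrite -(card_lt_pos x) -(card_lt_pos y).
by apply: eq_card=> w; rewrite !inE H.
Qed.

Lemma le_anti n (x y : {perm sgn n}) : le x y -> le y x -> x = y.
Proof.
move=> xy yx; have E u v : inv x u v = inv y u v by apply/idP/idP; [exact: xy|exact: yx].
apply: pos_eq_bef => u v; have := E u v; have := E v u; rewrite /inv.
have := eq_pos x u v; have := eq_pos y u v; rewrite eq_key; lia.
Qed.

(** The position of [u] is the number of values below it. Since [negT] reverses [r], the values
    above [u] mirror those below [negT u], so the ranks of [u] and [negT u] add up to [2n - 1], and
    the permutation is signed. *)
Lemma perm_of_order n (r : rel (sgn n)) :
  irreflexive r -> transitive r -> (forall u v, u != v -> r u v || r v u) ->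
  (forall u v, r (negT u) (negT v) = r v u) ->
  exists2 x : {perm sgn n}, signed x & forall u v, (pos x u < pos x v) = r u v.
Proof.
move=> ir tr tot sym; pose rk u := #|[set w | r w u]|.
have rk_lt u v : r u v -> rk u < rk v.
  move=> ruv; apply: proper_card; apply/properP; split.
    by apply/subsetP=> w; rewrite !inE => /tr; apply.
  by exists u; rewrite !inE ?ruv ?ir.
have rkE u v : (rk u < rk v) = r u v.
  apply/idP/idP; last exact: rk_lt.
  case: (eqVneq u v) => [->|/tot]; first by rewrite ltnn.
  by case/orP=> // /rk_lt H1 H2; move: (ltn_trans H1 H2); rewrite ltnn.
have rk_inj : injective rk.
  move=> u v E; apply/eqP; case: (eqVneq u v) => // /tot.
  by rewrite -!rkE E ltnn.
have rk_neg u : rk (negT u) + rk u + 1 = n.*2.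
  have -> : rk (negT u) = #|[set w | r u w]|.
    rewrite /rk -(card_imset _ (inv_inj (@negTK n))); congr #|pred_of_set _|.
    apply/setP=> w; rewrite !inE; apply/imsetP/idP => [[v]|H].
      by rewrite inE -sym negTK => H ->.
    by exists (negT w); rewrite ?negTK // inE sym.
  have <- : #|[set: sgn n]| = n.*2.
    by rewrite cardsT card_prod card_bool card_ord mul2n.
  rewrite (cardsD1 u [set: sgn n]) inE addn1 add1n; congr (_.+1).
  rewrite -cardsUI.
  have -> : [set w | r u w] :&: [set w | r w u] = set0.
    apply/setP=> w; rewrite !inE; apply/negP=> /andP[H1 H2].
    by move: (tr _ _ _ H1 H2); rewrite ir.
  rewrite cards0 addn0; apply: eq_card=> w; rewrite !inE andbT.
  apply/idP/idP => [/orP[]|/tot]; last by rewrite orbC.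
    by apply: contraTneq => ->; rewrite ir.
  by apply: contraTneq => ->; rewrite ir.
have rk_lt2 u : rk u < n.*2 by have := rk_neg u; lia.
have fP u : exists a : sgn n, key a == rk u by have [a <-] := key_surj (rk_lt2 u); exists a.
pose f u := xchoose (fP u).
have fK u : key (f u) = rk u by apply/eqP/(xchooseP (fP u)).
have f_inj : injective f by move=> u v E; apply: rk_inj; rewrite -!fK E.
have posE u : pos ((perm f_inj)^-1)%g u = rk u by rewrite /pos invgK permE fK.
exists ((perm f_inj)^-1)%g => [|u v]; last by rewrite !posE.
apply: signedV => u; apply: key_inj; rewrite !permE.
by have := key_neg (f u); have := rk_neg u; rewrite !fK; lia.
Qed.

(** The two transpositions would cancel when [c] is [negT a], hence the separate case. In
    [x * refl a c] the factor [x] is applied first, so the multiplication exchanges values, not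
    positions. *)
Definition refl n (a c : sgn n) : {perm sgn n} :=
  if c == negT a then tperm a c else (tperm a c * tperm (negT a) (negT c))%g.

Lemma reflE n (a c u : sgn n) : a != c ->
  refl a c u = if u == a then c else if u == c then a else
               if u == negT a then negT c else if u == negT c then negT a else u.
Proof.
rewrite /refl => ac; have ka := key_neg a; have kc := key_neg c.
rewrite !eq_key in ac *.
have kE (v w : sgn n) : v <> w -> key v <> key w by move=> ? /key_inj.
have kS (v w : sgn n) : v = w -> key v = key w by move->.
case: eqP => E; rewrite ?permM.
  case: tpermP => [/kS ?|/kS ?|/kE ? /kE ?]; do ?[case: eqP => ?]; try lia; by [|apply: key_inj; lia].
case: (tpermP a c u) => [/kS ?|/kS ?|/kE ? /kE ?]; case: tpermP => [/kS ?|/kS ?|/kE ? /kE ?];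
  do ?[case: eqP => ?]; try lia; try by [|apply: key_inj; lia].
Qed.

Lemma refl_sym n (a c : sgn n) : refl a c = refl c a.
Proof.
case: (eqVneq a c) => [->//|ac].
have ca : c != a by rewrite eq_sym.
apply/permP=> u; rewrite !reflE //.
have := key_neg a; have := key_neg c; move: ac; rewrite !eq_key => ac ka kc.
by do ?[case: eqP => ?]; try lia; apply: key_inj; lia.
Qed.

Lemma refl_neg n (a c : sgn n) : refl (negT a) (negT c) = refl a c.
Proof.
case: (eqVneq a c) => [->|ac].
  by rewrite /refl !tperm1 !mulg1 !if_same.
have nac : negT a != negT c by rewrite (inj_eq (inv_inj (@negTK n))).
apply/permP=> u; rewrite !reflE // !negTK.
have := key_neg a; have := key_neg c; move: ac; rewrite !eq_key => ac ka kc.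
by do ?[case: eqP => ?]; try lia; apply: key_inj; lia.
Qed.

Lemma reflK n (a c : sgn n) : involutive (refl a c).
Proof.
move=> u; case: (eqVneq a c) => [->|ac].
  by rewrite /refl !tperm1 !mulg1 !if_same !perm1.
rewrite [X in refl a c X]reflE //; have := key_neg a; have := key_neg c.
move: (ac); rewrite !eq_key => ac' kc ka.
by do ?[case: eqP => ?]; rewrite reflE // !eq_key; do ?[case: eqP => ?]; try lia; apply: key_inj; lia.
Qed.

Lemma reflV n (a c : sgn n) : ((refl a c)^-1 = refl a c)%g.
Proof. by apply/permP=> u; apply: (@perm_inj _ (refl a c)); rewrite permKV reflK. Qed.

Lemma refl_signed n (a c : sgn n) : signed (refl a c).
Proof.
move=> u; case: (eqVneq a c) => [->|ac].
  by rewrite /refl !tperm1 !mulg1 !if_same !perm1.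
rewrite !reflE //; move: ac; rewrite !eq_key => ac.
have := key_neg a; have := key_neg c; have := key_neg u => ku kc ka.
by do ?[case: eqP => ?]; rewrite ?negTK; try lia; apply: key_inj; lia.
Qed.

Lemma pos_refl n (x : {perm sgn n}) a c u : pos (x * refl a c)%g u = pos x (refl a c u).
Proof. by rewrite /pos invMg reflV permM. Qed.

Lemma refl_sq n (x : {perm sgn n}) a c : (x * refl a c * refl a c)%g = x.
Proof. by rewrite -{2}[refl a c]reflV mulgK. Qed.

Definition adj n (x : {perm sgn n}) a c := pos x c == (pos x a).+1.

Lemma adj_neg n (x : {perm sgn n}) a c : signed x -> adj x (negT c) (negT a) = adj x a c.
Proof. move=> sx; rewrite /adj; have := pos_neg a sx; have := pos_neg c sx; lia. Qed.

Lemma pos_swap n (x : {perm sgn n}) a c u : signed x -> a != c ->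
  pos (x * refl a c)%g u =
    if pos x u == pos x a then pos x c else if pos x u == pos x c then pos x a else
    if pos x u == pos x (negT a) then pos x (negT c) else
    if pos x u == pos x (negT c) then pos x (negT a) else pos x u.
Proof.
by move=> sx ac; rewrite pos_refl reflE // !(inj_eq (@pos_inj n x)); do ?case: eqP.
Qed.

(** No entry stands between [a] and [c], so a third value keeps its side relative to both. The
    exclusions are the swapped pair and its mirror pair, each in both orders. *)
Lemma swap_bef n (x : {perm sgn n}) a c u v : signed x -> adj x a c ->
  ~~ ((u == a) && (v == c)) -> ~~ ((u == c) && (v == a)) ->
  ~~ ((u == negT c) && (v == negT a)) -> ~~ ((u == negT a) && (v == negT c)) ->
  (pos (x * refl a c)%g u < pos (x * refl a c)%g v) = (pos x u < pos x v).
Proof.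
move=> sx /eqP ac.
have anc : a != c by apply: contra_eqN ac => /eqP->; rewrite eq_sym neq_ltn leqnn orbT.
rewrite !pos_swap // !(eq_pos x).
have := pos_neg a sx; have := pos_neg c sx.
by do ?[case: eqP => ? //=]; lia.
Qed.

Lemma adj_swap n (x : {perm sgn n}) a c : signed x -> adj x a c -> adj (x * refl a c)%g c a.
Proof.
move=> sx /eqP ac; rewrite /adj !pos_refl !reflE; try by rewrite (eq_pos x); lia.
rewrite !eqxx; have /negbTE-> : c != a by rewrite (eq_pos x); lia.
by rewrite ac.
Qed.

Lemma inv_swap n (x : {perm sgn n}) a c u v : signed x -> adj x a c -> key a < key c ->
  inv (x * refl a c)%g u v =
  [|| inv x u v, (u == a) && (v == c) | (u == negT c) && (v == negT a)].
Proof.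
move=> sx adx ltac; have adx' := adj_swap sx adx.
have sy := signedM sx (refl_signed a c).
have anc : a != c by rewrite eq_key; lia.
case E1: ((u == a) && (v == c)) => /=.
  case/andP: E1 => /eqP-> /eqP->; rewrite orbT /inv ltac.
  by rewrite (eqP adx') leqnn.
case E2: ((u == negT c) && (v == negT a)) => /=.
  case/andP: E2 => /eqP-> /eqP->; rewrite orbT inv_neg // /inv ltac.
  by rewrite (eqP adx') leqnn.
rewrite orbF /inv; case ltuv: (key u < key v) => //=.
apply: swap_bef => //; rewrite ?[(v == _) && _]andbC ?E1 ?E2 // !eq_key; have := key_neg a; have := key_neg c; lia.
Qed.

Lemma adj_signed_swap n (x : {perm sgn n}) a c : signed x -> signed (x * refl a c)%g.
Proof. by move=> sx; apply: signedM sx (refl_signed a c). Qed.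

(** * Weak order and inversion sets *)

Lemma bool_crossing (P : pred nat) m M : m <= M -> P m -> ~~ P M ->
  exists k, [/\ m <= k, k < M, P k & ~~ P k.+1].
Proof.
elim: M => [|M IH] lemM Pm nPM; first by rewrite leqn0 in lemM; rewrite (eqP lemM) in Pm; rewrite Pm in nPM.
case: (boolP (P M)) => PM.
  by exists M; rewrite leqnn nPM; split => //; move: lemM; rewrite leq_eqVlt => /orP[/eqP E|//]; rewrite E (negbTE nPM) in Pm.
have [|k [H1 H2 H3 H4]] := IH _ Pm PM.
  by move: lemM; rewrite leq_eqVlt => /orP[/eqP E|//]; rewrite E (negbTE nPM) in Pm.
by exists k; split=> //; apply: ltnW.
Qed.

(* If no entry standing from [q] to [p] has a value strictly between them, some adjacent pair there
   jumps from at least [q] down to at most [p]. *)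
Lemma le_of_descents n (y y' : {perm sgn n}) :
  (forall c a p q, adj y c a -> key a <= key p -> key p < key q -> key q <= key c ->
     pos y q <= pos y c -> pos y a <= pos y p -> inv y' p q) -> le y y'.
Proof.
move=> H p q; have [m] := ubnP (key q - key p); elim: m p q => // m IH p q lem.
case/andP=> lt_pq lt_pos.
case: (boolP [exists r, [&& key p < key r, key r < key q, pos y q < pos y r & pos y r < pos y p]]).
  case/existsP=> r /and4P[h1 h2 h3 h4].
  by apply: (@inv_trans _ _ p r q); apply: IH; rewrite /inv ?h1 ?h2 ?h3 ?h4 //; lia.
move/existsPn=> none.
(* [P] holds at the position of [q] and fails at that of [p], so somewhere the values drop below
   [key q]; as no value strictly between [p] and [q] stands there, they drop to at most [key p]. *)
pose P k := [exists u, (pos y u == k) && (key q <= key u)].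
have [|||k [k1 k2 Pk nPk]] := @bool_crossing P (pos y q) (pos y p); first exact: ltnW.
- by apply/existsP; exists q; rewrite eqxx leqnn.
- by apply/existsPn=> u; rewrite -eq_pos; apply/negP=> /andP[/eqP->]; rewrite leqNgt lt_pq.
case/existsP: Pk => c /andP[/eqP pc kc].
have [|a pa] := @pos_surj _ y k.+1; first by apply: leq_ltn_trans (pos_lt y p).
have ka : key a < key q.
  by rewrite ltnNge; apply: contra nPk => h; apply/existsP; exists a; rewrite pa eqxx.
have ka' : key a <= key p.
  rewrite leqNgt; apply/negP => lt_pa; have := none a; rewrite lt_pa ka /= pa ltnS k1 /= -leqNgt => h.
  have /eqP : pos y a == pos y p by rewrite pa eqn_leq k2 h.
  by move/pos_inj => E; rewrite E ltnn in lt_pa.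
apply: (H c a) => //; first by rewrite /adj pa pc.
  by rewrite pc.
by rewrite pa.
Qed.

Lemma pos1 n (u : sgn n) : pos 1 u = key u.
Proof. by rewrite /pos invg1 perm1. Qed.

Lemma inv1 n (u v : sgn n) : inv 1 u v = false.
Proof. rewrite /inv !pos1; lia. Qed.

Lemma no_descent n (x : {perm sgn n}) :
  (forall c a, adj x c a -> key a <= key c -> False) -> x = 1%g.
Proof.
move=> H; apply: le_anti => [|u v]; last by rewrite inv1.
by apply: le_of_descents => c a p q /H h *; case: h; lia.
Qed.

(** A pair and its mirror image are counted separately, so this is a decreasing measure for
    inductions rather than the Coxeter length. *)
Definition ninv n (x : {perm sgn n}) := #|[set p : sgn n * sgn n | inv x p.1 p.2]|.

Lemma ninv_lt n (x y : {perm sgn n}) a c : le x y -> inv y a c -> ~~ inv x a c -> ninv x < ninv y.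
Proof.
move=> xy ya xa; apply: proper_card; apply/properP; split.
  by apply/subsetP=> [[u v]]; rewrite !inE; apply: xy.
by exists (a, c); rewrite inE.
Qed.

Lemma unswap n (x : {perm sgn n}) c a : signed x -> adj x c a -> key a < key c ->
  exists y, [/\ signed y, adj y a c, x = (y * refl a c)%g, ninv y < ninv x & le y x].
Proof.
move=> sx ad lt_ac; exists (x * refl c a)%g.
have sy := adj_signed_swap c a sx; have ady := adj_swap sx ad.
have E : x = (x * refl c a * refl a c)%g by rewrite (refl_sym a) refl_sq.
move: (x * refl c a)%g sy ady E => y sy ady E.
have invE u v : inv x u v = [|| inv y u v, (u == a) && (v == c) | (u == negT c) && (v == negT a)].
  by rewrite E inv_swap.
have lyx : le y x by move=> u v Hy; rewrite invE Hy.
split=> //; apply: (@ninv_lt _ _ _ a c) => //; first by rewrite invE !eqxx orbT.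
by rewrite /inv negb_and -!leqNgt (eqP ady) leqnSn orbT.
Qed.

(** * Generators, words and length *)

Definition ps n (i : 'I_n) : sgn n := if val i == 0 then (true, i) else (false, predo i).

Lemma key_ps n (i : 'I_n) : key (false, i) = (key (ps i)).+1.
Proof.
rewrite /ps; have := ltn_ord i; case: eqP => /= i0 lt_i; rewrite /key /=; first by lia.
by rewrite /predo val_insubd; case: ifP => ?; lia.
Qed.

Lemma genE n (i : 'I_n) : gen i = refl (ps i) (false, i).
Proof.
rewrite /gen /ps /refl /=; case: ifP => i0; first by rewrite /negT eqxx tpermC.
by [].
Qed.

Lemma gen_signed n (i : 'I_n) : signed (gen i).
Proof. rewrite genE; exact: refl_signed. Qed.

Lemma refl_conj n (x : {perm sgn n}) a c : signed x -> (refl a c * x = x * refl (x a) (x c))%g.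
Proof.
move=> sx; apply/permP=> u; rewrite !permM.
case: (eqVneq a c) => [->|ac]; first by rewrite /refl !tperm1 !mulg1 !if_same !perm1.
rewrite !reflE // ?(inj_eq (@perm_inj _ x)) // -!sx !(inj_eq (@perm_inj _ x)).
by do ?case: ifP.
Qed.

(** In this product the generator is applied first, so it permutes positions; conjugation by [x]
    turns it into a swap of the two values standing there. *)
Lemma gen_mul n (x : {perm sgn n}) i : signed x ->
  (gen i * x = x * refl (x (ps i)) (x (false, i)))%g /\ adj x (x (ps i)) (x (false, i)).
Proof. by move=> sx; rewrite genE refl_conj // /adj /pos !permK key_ps. Qed.

Lemma adj_gen n (x : {perm sgn n}) a c : signed x -> adj x a c ->
  exists i, (gen i * x = x * refl a c)%g.
Proof.
(* Of the pair and its mirror image, one has its right-hand entry at a positive position. *)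
move=> sx; wlog [i Hi] : a c / exists i, (x^-1 c)%g = (false, i).
  move=> W ad; case E: (x^-1 c)%g => [[] i]; last by apply: W => //; exists i.
  case E': (x^-1 a)%g => [[] j].
    have [||k Hk] := W (negT c) (negT a).
    - by exists j; rewrite signedV // E'.
    - by rewrite adj_neg.
    by exists k; rewrite Hk refl_neg refl_sym.
  move: ad; rewrite /adj /pos E E' /key /=; have := ltn_ord j; have := ltn_ord i; lia.
move=> ad; exists i; have [-> _] := gen_mul i sx; rewrite -Hi permKV.
congr (x * refl _ _)%g; apply: (@perm_inj _ x^-1%g); rewrite permK; apply: key_inj.
by move: ad; rewrite /adj /pos Hi key_ps => /eqP[].
Qed.

Lemma wprod_rcons n (s : seq 'I_n) i : wprod (rcons s i) = (gen i * wprod s)%g.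
Proof.
rewrite /wprod; elim: s => [|j s IH] /=; first by rewrite /Defs.comp mul1g mulg1.
by rewrite IH /Defs.comp mulgA.
Qed.

Lemma wprod_signed n (s : seq 'I_n) : signed (wprod s).
Proof.
elim: s => [|j s IH] /=; first exact: signed1.
by apply: signedM => //; apply: gen_signed.
Qed.

Lemma wprod_surj n (x : {perm sgn n}) : signed x -> exists s, wprod s = x.
Proof.
have [m] := ubnP (ninv x); elim: m x => // m IH x lex sx.
case: (boolP [exists p, adj x p.1 p.2 && (key p.2 < key p.1)]).
  case/existsP=> [[c a]] /= /andP[ad lt_ac].
  have [y [sy ady E lty _]] := unswap sx ad lt_ac.
  have [|s Hs] := IH y _ sy; first by rewrite ltnS in lex; apply: leq_trans lty lex.
  have [i Hi] := adj_gen sy ady.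
  by exists (rcons s i); rewrite wprod_rcons Hs Hi -E.
move/existsPn=> H; exists [::]; rewrite (@no_descent _ x) // => c a ad lt_ac.
have := H (c, a); rewrite /= ad /= -leqNgt => h.
have E : key a = key c by apply/eqP; rewrite eqn_leq lt_ac.
by move: ad; rewrite /adj (key_inj E); lia.
Qed.

(** This is the strong exchange condition. The inversion is either present before the last letter,
    and a letter is deleted there by induction, or created by the last letter, which is then the one
    to delete. *)
Lemma exchange n (s : seq 'I_n) u v : inv (wprod s) u v ->
  reflection (refl u v) /\
  exists2 s', size s' < size s & wprod s' = (wprod s * refl u v)%g.
Proof.
elim/last_ind: s u v => [|s i IH] u v; first by rewrite inv1.
have sw := wprod_signed s; rewrite wprod_rcons size_rcons.
case: (boolP (inv (wprod s) u v)) => [/IH[r [s' lts Hs']] _|ninv].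
  split=> //; exists (rcons s' i); first by rewrite size_rcons.
  by rewrite wprod_rcons Hs' mulgA.
have [E ad] := gen_mul i sw; set a := _ (ps i) in E ad; set c := _ (false, i) in E ad.
rewrite E => Hinv.
have R : refl u v = refl a c.
  case: (ltngtP (key a) (key c)) => Hk.
  - move: Hinv; rewrite inv_swap // (negbTE ninv) /=.
    by case/orP=> /andP[/eqP-> /eqP->]; rewrite // refl_neg refl_sym.
  - case/negP: ninv.
    rewrite -(refl_sq (wprod s) a c) [X in (_ * X)%g]refl_sym inv_swap ?Hinv //.
      exact: adj_signed_swap.
    exact: adj_swap.
  by move: ad; rewrite /adj (key_inj Hk); lia.
split.
  exists ((wprod s)^-1)%g, i; split; first exact: signedV.
  by rewrite R invgK -mulgA E mulKg.
by exists s; rewrite // R refl_sq.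
Qed.

Lemma haslen_ex n (w : {perm sgn n}) s : wprod s = w -> exists2 k, haslen w k & k <= size s.
Proof.
move=> Hs; pose P k := [exists t : k.-tuple 'I_n, wprod t == w].
have exP : exists k, P k by exists (size s); apply/existsP; exists (in_tuple s); apply/eqP.
exists (ex_minn exP); case: ex_minnP => k Pk Hk.
  split; first by have /existsP[t /eqP Ht] := Pk; exists t; rewrite size_tuple.
  by move=> s' Hs'; apply: Hk; apply/existsP; exists (in_tuple s'); apply/eqP.
by apply: Hk; apply/existsP; exists (in_tuple s); apply/eqP.
Qed.

Lemma haslen_uniq n (w : {perm sgn n}) k k' : haslen w k -> haslen w k' -> k = k'.
Proof.
by move=> [[s [<- /= Hs]] H1] [[s' [<- Hs']] H2]; apply/eqP; rewrite eqn_leq H1 ?H2.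
Qed.

(** For an inversion, the exchange condition shortens a reduced word. Otherwise the pair is an
    inversion of [w * refl u v], whose length drops on multiplying back to [w], so the length of [w]
    cannot have dropped. *)
Lemma inv_setP n (w : {perm sgn n}) u v : signed w -> key u < key v ->
  inv_set w (refl u v) <-> inv w u v.
Proof.
have short (w' : {perm sgn n}) : signed w' -> inv w' u v -> 
   reflection (refl u v) /\ exists k1 k2, [/\ haslen (w' * refl u v)%g k1, haslen w' k2 & k1 < k2].
  move=> sw' Hi; have [s0 Hs0] := wprod_surj sw'; have [k Hk _] := haslen_ex Hs0.
  have [[s [szs Hs]] _] := Hk; rewrite -Hs in Hi.
  have [r [s' lts Hs']] := exchange Hi; split=> //.
  have [k1 Hk1 lek1] := haslen_ex Hs'; exists k1, k; rewrite -Hs; split=> //.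
    by rewrite Hs.
  by rewrite -szs; apply: leq_ltn_trans lts.
move=> sw lt_uv; split=> [[_ [k1 [k2 [H1 [H2 lt12]]]]]|/(short _ sw)[r [k1 [k2 [H1 H2 H3]]]]]; last first.
  by split=> //; exists k1, k2.
rewrite /inv lt_uv /= ltnNge leq_eqVlt negb_or -eq_pos eq_key neq_ltn lt_uv /=.
apply/negP=> Hlt; have uv : u != v by rewrite eq_key; lia.
have [||_ [k3 [k4 [H3 H4 lt34]]]] := short (w * refl u v)%g; first exact: adj_signed_swap.
  rewrite /inv lt_uv !pos_refl !reflE // !eqxx (eq_sym v u) (negbTE uv) //.
rewrite refl_sq in H3.
by have := haslen_uniq H1 H4; have := haslen_uniq H2 H3; lia.
Qed.

Lemma reflection_refl n (t : {perm sgn n}) : reflection t ->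
  exists u v, key u < key v /\ t = refl u v.
Proof.
case=> w [i [sw ->]]; have sV := signedV sw.
have E : (w * gen i * w^-1 = refl (w^-1 (ps i)) (w^-1 (false, i)))%g.
  by rewrite -mulgA genE refl_conj // mulKVg.
rewrite E; case: (ltngtP (key (w^-1 (ps i))%g) (key (w^-1 (false, i))%g)) => Hk.
- by exists (w^-1 (ps i))%g, (w^-1 (false, i))%g.
- by exists (w^-1 (false, i))%g, (w^-1 (ps i))%g; split=> //; apply: refl_sym.
by move/key_inj/perm_inj: Hk => /(congr1 (@key n)); rewrite key_ps; lia.
Qed.

Lemma wleP n (x y : {perm sgn n}) : signed x -> signed y -> wle x y <-> le x y.
Proof.
move=> sx sy; split=> [H u v Hx|H t Ht].
  have lt_uv := inv_lt Hx.
  by apply/(inv_setP sy lt_uv)/H/(inv_setP sx lt_uv).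
have [u [v [lt_uv E]]] := reflection_refl Ht.1; rewrite E in Ht *.
by apply/(inv_setP sy lt_uv)/H/(inv_setP sx lt_uv).
Qed.

(** * Joins, meets and congruences *)

Lemma is_joinP n (a b j : {perm sgn n}) : signed a -> signed b ->
  is_join a b j <->
  [/\ signed j, le a j, le b j & forall k, signed k -> le a k -> le b k -> le j k].
Proof.
move=> sa sb; split=> [[sj [aj [bj H]]]|[sj aj bj H]].
  split; rewrite -?wleP // => k sk; rewrite -!wleP //; exact: H.
split=> //; rewrite !wleP //; do 2!split=> //.
by move=> k sk; rewrite !wleP //; exact: H.
Qed.

Lemma is_meetP n (a b m : {perm sgn n}) : signed a -> signed b ->
  is_meet a b m <->
  [/\ signed m, le m a, le m b & forall k, signed k -> le k a -> le k b -> le k m].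
Proof.
move=> sa sb; split=> [[sj [aj [bj H]]]|[sj aj bj H]].
  split; rewrite -?wleP // => k sk; rewrite -!wleP //; exact: H.
split=> //; rewrite !wleP //; do 2!split=> //.
by move=> k sk; rewrite !wleP //; exact: H.
Qed.

(* The inversions of the join are the transitive closure of the union of the inversion sets. *)
Lemma join_ex n (x y : {perm sgn n}) : signed x -> signed y -> exists j, is_join x y j.
Proof.
move=> sx sy; pose A : rel (sgn n) := fun u v => inv x u v || inv y u v.
have A_lt u v : A u v -> key u < key v by case/orP=> /inv_lt.
have A_neg u v : A (negT v) (negT u) = A u v by rewrite /A !inv_neg.
pose C u v := connect A u v && (key u < key v).
have AC u v : A u v -> C u v by move=> h; rewrite /C A_lt // connect1.
have C_lt u v : C u v -> key u < key v by case/andP.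
have C_tr u v w : C u v -> C v w -> C u w.
  move=> /andP[c1 l1] /andP[c2 l2]; rewrite /C (connect_trans c1 c2); lia.
(* Follow a chain of inversions from [u] to [w]: a step that jumps over [v] is an inversion of [x]
   or of [y], so it splits at [v]. *)
have C_cotr u v w : key u < key v -> key v < key w -> C u w -> C u v || C v w.
  move=> uv vw /andP[/connectP[p pp Ew] _]; elim: p u uv pp Ew => [|u1 p IH] u uv /=.
    by move=> _ E; rewrite E in vw; lia.
  case/andP=> uu1 pp Ew; case: (ltngtP (key v) (key u1)) => H.
  - have /orP[h|h] : A u v || A v u1.
      by case/orP: uu1 => /(inv_cotrans uv H) /orP[]; rewrite /A => ->; rewrite ?orbT.
    + by rewrite AC.
    rewrite [C v w]/C vw andbT (connect_trans (connect1 h)) ?orbT //.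
    by apply/connectP; exists p.
  - have /orP[h|->] := IH u1 H pp Ew; last by rewrite orbT.
    by rewrite (C_tr _ _ _ (AC _ _ uu1)).
  by rewrite (key_inj H) AC.
have C_neg1 u v : C u v -> C (negT v) (negT u).
  case/andP=> c uv; rewrite /C; have -> : key (negT v) < key (negT u).
    by have := key_neg u; have := key_neg v; lia.
  rewrite andbT; case/connectP: c => p pp -> {uv}.
  elim: p u pp => [|u1 p IH] u //= /andP[uu1 /IH h].
  by apply: connect_trans h _; apply: connect1; rewrite A_neg.
have C_neg u v : C (negT v) (negT u) = C u v.
  by apply/idP/idP => /C_neg1; rewrite ?negTK.
(* Among increasing pairs both [C] and its complement are transitive, so reversing exactly the pairs
   in [C] yields a total order. *)
pose r u v := if key u < key v then ~~ C u v else C v u.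
have [||||j sj Ej] := @perm_of_order _ r.
- by move=> u; rewrite /r ltnn; apply/negP=> /C_lt; rewrite ltnn.
- move=> v u w; rewrite /r.
  have irr a : C a a = false by apply/negP=> /C_lt; rewrite ltnn.
  have as1 a b : C a b -> C b a -> false by move=> /C_lt h /C_lt; lia.
  case: (ltngtP (key u) (key v)) => [uv|vu|/key_inj->]; last by rewrite irr.
    case: (ltngtP (key v) (key w)) => [vw|wv|/key_inj->]; last by rewrite irr.
      rewrite (ltn_trans uv vw) => h1 h2; apply/negP=> /(C_cotr _ _ _ uv vw).
      by rewrite (negbTE h1) (negbTE h2).
    move=> h1 h2; case: (ltngtP (key u) (key w)) => [uw|wu|/key_inj E].
    - by apply: contra h1 => /C_tr; apply.
    - by have := C_cotr _ _ _ wu uv h2; rewrite (negbTE h1) orbF.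
    by rewrite E h2 in h1.
  case: (ltngtP (key v) (key w)) => [vw|wv|/key_inj->]; last by rewrite irr.
    move=> h1 h2; case: (ltngtP (key u) (key w)) => [uw|wu|/key_inj E].
    - by apply: contra h2; apply: C_tr.
    - by have := C_cotr _ _ _ vw wu h1; rewrite (negbTE h2).
    by rewrite -E h1 in h2.
  by rewrite ltnNge (ltnW (ltn_trans wv vu)) /= => h1 h2; apply: C_tr h2 h1.
- by move=> u v; rewrite eq_key /r; case: ltngtP => //= _ _; rewrite ?orNb ?orbN.
- move=> u v; rewrite /r !C_neg.
  by have -> : (key (negT u) < key (negT v)) = (key v < key u)
    by have := key_neg u; have := key_neg v; lia.
exists j; apply/is_joinP => //.
have invj u v : inv j u v = C u v.
  rewrite /inv Ej /r; case: ltngtP => //= h; apply/esym/negbTE/negP=> /C_lt; lia.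
split=> //.
- by move=> u v h; rewrite invj AC // /A h.
- by move=> u v h; rewrite invj AC // /A h orbT.
move=> k sk xk yk u v; rewrite invj => /andP[/connectP[p pp Ev] lt_uv].
have : (u == v) || inv k u v.
  rewrite {lt_uv}; elim: p u pp Ev => [|u1 p IH] u /=; first by move=> _ ->; rewrite eqxx.
  case/andP=> uu1 pp Ev; have h : inv k u u1 by case/orP: uu1; [apply: xk|apply: yk].
  have /orP[/eqP <-|h'] := IH u1 pp Ev; first by rewrite h orbT.
  by rewrite (inv_trans h h') orbT.
by case/orP=> // /eqP E; rewrite E ltnn in lt_uv.
Qed.

(** * Reversal and meets *)

Definition negp n : {perm sgn n} := perm (inv_inj (@negTK n)).

(* Reversal of the full notation, an anti-automorphism of the weak order. *)
Definition dual n (x : {perm sgn n}) : {perm sgn n} := (x * negp n)%g.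

Lemma negpE n (u : sgn n) : negp n u = negT u.
Proof. exact: permE. Qed.

Lemma negpV n : ((negp n)^-1 = negp n)%g.
Proof. by apply/permP=> u; apply: (@perm_inj _ (negp n)); rewrite permKV !permE negTK. Qed.

Lemma dualK n : involutive (@dual n).
Proof. by move=> x; rewrite /dual -{2}negpV mulgK. Qed.

Lemma dual_signed n (x : {perm sgn n}) : signed x -> signed (dual x).
Proof. by move=> sx u; rewrite !permM !permE sx. Qed.

Lemma pos_dual n (x : {perm sgn n}) u : signed x -> pos (dual x) u + pos x u + 1 = n.*2.
Proof. by move=> sx; rewrite {1}/pos /dual invMg negpV permM negpE; apply: pos_neg. Qed.

Lemma inv_dual n (x : {perm sgn n}) u v : signed x ->
  inv (dual x) u v = (key u < key v) && ~~ inv x u v.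
Proof.
move=> sx; rewrite /inv; have := pos_dual u sx; have := pos_dual v sx.
have := eq_pos x u v; rewrite eq_key; lia.
Qed.

Lemma le_dual n (x y : {perm sgn n}) : signed x -> signed y -> le x y -> le (dual y) (dual x).
Proof.
move=> sx sy xy u v; rewrite !inv_dual // => /andP[-> /=]; apply: contra; exact: xy.
Qed.

Lemma le_dualE n (x y : {perm sgn n}) : signed x -> signed y ->
  le x (dual y) <-> le y (dual x).
Proof.
move=> sx sy; split=> h.
  by rewrite -[y]dualK; apply: le_dual => //; apply: dual_signed.
by rewrite -[x]dualK; apply: le_dual => //; apply: dual_signed.
Qed.

Lemma is_meet_dual n (a b m : {perm sgn n}) : signed a -> signed b ->
  is_join (dual a) (dual b) m -> is_meet a b (dual m).
Proof.
move=> sa sb; have da := dual_signed sa; have db := dual_signed sb.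
case/(is_joinP _ da db) => sm am bm H; apply/is_meetP => //; split.
- exact: dual_signed.
- by rewrite -[a]dualK; apply: le_dual.
- by rewrite -[b]dualK; apply: le_dual.
move=> k sk ka kb; apply/le_dualE => //; apply: H; try exact: dual_signed; exact: le_dual.
Qed.

Lemma is_join_dual n (a b j : {perm sgn n}) : signed a -> signed b ->
  is_join a b j -> is_meet (dual a) (dual b) (dual j).
Proof.
move=> sa sb H; apply: is_meet_dual; rewrite ?dualK //; exact: dual_signed.
Qed.

Lemma meet_ex n (x y : {perm sgn n}) : signed x -> signed y -> exists m, is_meet x y m.
Proof.
move=> sx sy; have [j Hj] := join_ex (dual_signed sx) (dual_signed sy).
by exists (dual j); apply: is_meet_dual.
Qed.

(** * Convexity and forcing in an arbitrary congruence *)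

Section Congruence.
Variables (n : nat) (R : {perm sgn n} -> {perm sgn n} -> Prop).
Hypothesis congR : lat_cong R.

Lemma cong_signed x y : R x y -> signed x /\ signed y.
Proof. by case: congR => H _; apply: H. Qed.

Lemma cong_refl x : signed x -> R x x.
Proof. by case: congR => _ [H _]; apply: H. Qed.

Lemma cong_sym x y : R x y -> R y x.
Proof. by case: congR => _ [_ [H _]]; apply: H. Qed.

Lemma cong_trans y x z : R x y -> R y z -> R x z.
Proof. by case: congR => _ [_ [_ [H _]]]; apply: H. Qed.

Lemma cong_join x y z j1 j2 : signed z -> R x y -> is_join x z j1 -> is_join y z j2 -> R j1 j2.
Proof. by case: congR => _ [_ [_ [_ [H _]]]]; apply: H. Qed.

Lemma cong_meet x y z m1 m2 : signed z -> R x y -> is_meet x z m1 -> is_meet y z m2 -> R m1 m2.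
Proof. by case: congR => _ [_ [_ [_ [_ H]]]]; apply: H. Qed.

Lemma cong_convex x y z : signed y -> le x y -> le y z -> R x z -> R x y.
Proof.
move=> sy xy yz Rxz; have [sx sz] := cong_signed Rxz.
apply: (@cong_meet _ _ y _ _ sy Rxz); apply/is_meetP => //; split=> //; exact: le_refl.
Qed.

(** Joining with [x] makes [x] congruent to the join of [v] and [x], and [y] lies between these
    two. *)
Lemma cong_up u v x y : R u v -> signed x -> signed y -> le u x -> le x y ->
  (forall k, signed k -> le x k -> le v k -> le y k) -> R x y.
Proof.
move=> Ruv sx sy ux xy H; have [su sv] := cong_signed Ruv.
have [j Hj] := join_ex sv sx; have [sj vj xj _] := (is_joinP j sv sx).1 Hj.
apply: (@cong_convex _ _ j) => //; first exact: H.
apply: (cong_join sx Ruv _ Hj); apply/is_joinP => //; split=> //; exact: le_refl.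
Qed.

(** Meeting with [y] makes [y] congruent to its meet with [u], which lies below [x]; joining with
    [x] then relates [x] and [y]. *)
Lemma cong_down u v x y : R u v -> signed x -> signed y -> le y v -> le x y ->
  (forall k, signed k -> le k y -> le k u -> le k x) -> R x y.
Proof.
move=> Ruv sx sy yv xy H; have [su sv] := cong_signed Ruv.
have [m Hm] := meet_ex su sy; have [sm mu my _] := (is_meetP m su sy).1 Hm.
have Rmy : R m y.
  apply: (cong_meet sy Ruv Hm); apply/is_meetP => //; split=> //; exact: le_refl.
apply: (cong_join sx Rmy); apply/is_joinP => //; split=> //; try exact: le_refl.
exact: H.
Qed.
End Congruence.

(** * The classes generated by contracted covers *)

(* An adjacent pair [a < c] may be swapped inside a class when some value [b] strictly between
   them is up and stands before them, or is down and stands after them. *)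
Definition contr n (U : pred (sgn n)) (x : {perm sgn n}) (a c : sgn n) : bool :=
  [exists b, [&& key a < key b, key b < key c &
    if U b then pos x b < pos x a else pos x a < pos x b]].

Inductive ceq n (U : pred (sgn n)) : {perm sgn n} -> {perm sgn n} -> Prop :=
| ceq_refl x : signed x -> ceq U x x
| ceq_step x a c : signed x -> adj x a c -> key a < key c -> contr U x a c ->
    ceq U x (x * refl a c)%g
| ceq_sym x y : ceq U x y -> ceq U y x
| ceq_trans y x z : ceq U x y -> ceq U y z -> ceq U x z.

Definition bottom n (U : pred (sgn n)) (x : {perm sgn n}) : Prop :=
  forall c a, adj x c a -> key a < key c -> ~~ contr U (x * refl c a)%g a c.

(** These pairs are inverted when [c] and the intermediate down values stand before [a] and the
    intermediate up values, as they must around a cover that is not contracted. *)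
Definition Treq n (U : pred (sgn n)) (a c p q : sgn n) : bool :=
  [&& key a <= key p, key p < key q, key q <= key c, (p == a) || U p & (q == c) || ~~ U q].

(* The inversions of the join-irreducible element attached to [a < c] which is not contracted:
   [T U x a c] says that [x] lies above it. *)
Definition T n (U : pred (sgn n)) (x : {perm sgn n}) (a c : sgn n) : Prop :=
  forall p q, Treq U a c p q -> inv x p q.

Ltac mlia := repeat match goal with
  | H : context [in_mem] |- _ => clear H
  | H : is_true (adj _ _ _) |- _ => clear H
  | H : is_true (contr _ _ _ _) |- _ => clear H
  | H : is_true (~~ contr _ _ _ _) |- _ => clear H
  | H : signed _ |- _ => clear H
  | H : le _ _ |- _ => clear H
  | H : ceq _ _ _ |- _ => clear H
  end; lia.

Lemma ceq_signed n (U : pred (sgn n)) x y : ceq U x y -> signed x /\ signed y.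
Proof.
elim=> [//|{}x a c sx _ _ _|{}x {}y _ []//|{}y {}x z _ [? _] _ [_ ?]] //.
by split=> //; apply: adj_signed_swap.
Qed.

Lemma swap_bef_l n (x : {perm sgn n}) a c b : signed x -> adj x a c -> b != a -> b != c ->
  (pos (x * refl a c)%g b < pos (x * refl a c)%g a) = (pos x b < pos x a).
Proof.
move=> sx ad ba bc; apply: swap_bef => //; move: ba bc; rewrite !eq_key;
  have := key_neg a; have := key_neg c; lia.
Qed.

Lemma swap_bef_r n (x : {perm sgn n}) a c b : signed x -> adj x a c -> b != a -> b != c ->
  (pos (x * refl a c)%g c < pos (x * refl a c)%g b) = (pos x c < pos x b).
Proof.
move=> sx ad ba bc; apply: swap_bef => //; move: ba bc; rewrite !eq_key;
  have := key_neg a; have := key_neg c; lia.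
Qed.

Lemma adj_bef n (x : {perm sgn n}) a c b : adj x a c -> b != a -> b != c ->
  (pos x b < pos x a) = (pos x b < pos x c).
Proof. move=> /eqP ad; rewrite !(eq_pos x); lia. Qed.

Lemma adj_aft n (x : {perm sgn n}) a c b : adj x a c -> b != a -> b != c ->
  (pos x a < pos x b) = (pos x c < pos x b).
Proof. move=> /eqP ad; rewrite !(eq_pos x); lia. Qed.

Lemma swap_rel n (x : {perm sgn n}) a c b : signed x -> adj x a c -> b != a -> b != c ->
  let y := (x * refl a c)%g in
  [/\ (pos y b < pos y a) = (pos x b < pos x a), (pos y b < pos y c) = (pos x b < pos x a),
      (pos y a < pos y b) = (pos x a < pos x b) & (pos y c < pos y b) = (pos x a < pos x b)].
Proof.
move=> sx ad ba bc y; have ady : adj y c a := adj_swap sx ad.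
have E := swap_bef_l sx ad ba bc; have E' := swap_bef_r sx ad ba bc.
have A1 := adj_bef ady bc ba; have A2 := adj_aft ady bc ba; have A3 := adj_aft ad ba bc.
by split; rewrite /y ?A1 -?A2 ?E ?E' -?A3.
Qed.

(** * Invariants of the classes and compatibility with meets *)

Section Cong.
Variables (n : nat) (U : pred (sgn n)).
Hypothesis UN : forall a, U (negT a) = ~~ U a.
Implicit Types x y z : {perm sgn n}.

Lemma ltn_key_neg (u v : sgn n) : (key (negT u) < key (negT v)) = (key v < key u).
Proof. have := key_neg u; have := key_neg v; lia. Qed.

Lemma ltn_pos_neg x u v : signed x -> (pos x (negT u) < pos x (negT v)) = (pos x v < pos x u).
Proof. move=> sx; have := pos_neg u sx; have := pos_neg v sx; lia. Qed.

Lemma contr_neg x a c : signed x -> adj x a c -> contr U x a c -> contr U x (negT c) (negT a).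
Proof.
move=> sx ad /existsP[b /and3P[ab bc Hb]]; apply/existsP; exists (negT b).
have ba : b != a by rewrite eq_key; lia.
have bc' : b != c by rewrite eq_key; lia.
rewrite !ltn_key_neg ab bc UN; case: (U b) Hb => Hb /=; rewrite ltn_pos_neg //.
  by rewrite -(adj_bef ad).
by rewrite -(adj_aft ad).
Qed.

(** If [(a, c)] were required, so would be [(b, c)] for an up witness [b], or [(a, b)] for a down
    one. These are not inverted, since [b] stands before both entries, or after both. *)
Lemma T_step1 x a c a' c' : signed x -> adj x a c -> key a < key c -> contr U x a c ->
  T U (x * refl a c)%g a' c' -> ~~ Treq U a' c' a c.
Proof.
move=> sx ad ac /existsP[b /and3P[ab bc Hb]] Ty; apply/negP => /and5P[h1 h2 h3 h4 h5].
have ba : b != a by rewrite eq_key; lia.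
have bc' : b != c by rewrite eq_key; lia.
have [E1 E2 E3 E4] := swap_rel sx ad ba bc'.
case: ifP Hb => Ub Hb.
  have /Ty /inv_pos : Treq U a' c' b c by rewrite /Treq Ub orbT h3 h5 bc (leq_trans h1) // ltnW.
  by move: E2; rewrite Hb; lia.
have /Ty /inv_pos : Treq U a' c' a b by rewrite /Treq Ub orbT h1 h4 ab ltnW // (leq_trans bc).
by move: E3; rewrite Hb; lia.
Qed.

Lemma T_step x a c a' c' : signed x -> adj x a c -> key a < key c -> contr U x a c ->
  T U x a' c' <-> T U (x * refl a c)%g a' c'.
Proof.
move=> sx ad ac ct; split=> [Tx p q /Tx|Ty p q Hpq]; first by rewrite inv_swap // => ->.
have := Ty p q Hpq; rewrite inv_swap // => /or3P[//|/andP[/eqP Ep /eqP Eq]|/andP[/eqP Ep /eqP Eq]].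
  by have := T_step1 sx ad ac ct Ty; rewrite -Ep -Eq Hpq.
have ad' : adj x (negT c) (negT a) by rewrite adj_neg.
have ac' : key (negT c) < key (negT a) by rewrite ltn_key_neg.
have R : refl (negT c) (negT a) = refl a c by rewrite refl_neg refl_sym.
have := T_step1 sx ad' ac' (contr_neg sx ad ct); rewrite R => /(_ _ _ Ty).
by rewrite -Ep -Eq Hpq.
Qed.

Lemma ceqT x y : ceq U x y -> forall a c, T U x a c <-> T U y a c.
Proof.
elim=> // [{}x a c sx ad ac ct a' c'|{}x {}y _ IH a c|{}y {}x z _ IH1 _ IH2 a c].
- exact: T_step.
- by rewrite IH.
by rewrite IH1.
Qed.

Lemma T_mono x y a c : le x y -> T U x a c -> T U y a c.
Proof. by move=> xy Tx p q /Tx /xy. Qed.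

Lemma descE x c a : signed x -> adj x c a -> key a < key c ->
  [/\ signed (x * refl c a)%g, adj (x * refl c a)%g a c & x = (x * refl c a * refl a c)%g].
Proof.
move=> sx ad ac; split; [exact: adj_signed_swap|exact: adj_swap|].
by rewrite (refl_sym a) refl_sq.
Qed.

Lemma ncontr_pos x c a b : signed x -> adj x c a -> key a < key b -> key b < key c ->
  ~~ contr U (x * refl c a)%g a c -> if U b then pos x a < pos x b else pos x b < pos x c.
Proof.
move=> sx ad ab bc /existsPn /(_ b).
have [|sy ady E] := descE sx ad; first lia.
have ba : b != a by rewrite eq_key; lia.
have bc' : b != c by rewrite eq_key; lia.
have [] := swap_rel sx ad bc' ba => E1 E2 E3 E4.
rewrite ab bc E2 E4 /=; have := eq_pos x b c; have := eq_pos x b a.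
by rewrite (negbTE ba) (negbTE bc'); move: ad; rewrite /adj; case: (U b); lia.
Qed.

Lemma bottom_T x c a : signed x -> bottom U x -> adj x c a -> key a < key c -> T U x a c.
Proof.
move=> sx bx ad ac p q /and5P[h1 h2 h3 h4 h5]; rewrite /inv h2 /=.
have nc := bx _ _ ad ac.
have Hp : pos x a <= pos x p.
  case: (eqVneq p a) h4 => [->//|pa /= Up].
  have := @ncontr_pos x c a p sx ad; rewrite Up => H.
  apply: ltnW; apply: H => //; last lia.
  by move: pa; rewrite eq_key; lia.
have Hq : pos x q <= pos x c.
  case: (eqVneq q c) h5 => [->//|qc /= Uq].
  have := @ncontr_pos x c a q sx ad; rewrite (negbTE Uq) => H.
  apply: ltnW; apply: H => //; first lia.
  by move: qc; rewrite eq_key; lia.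
by move/eqP: ad; lia.
Qed.

(** In [le_of_descents], [q] stands weakly before the descent [c a] and [p] weakly after it. As the
    descent is not contracted, [p] is [a] or up and [q] is [c] or down, so [T] covers the pair. *)
Lemma le_of_T x y : signed x -> bottom U x ->
  (forall c a, adj x c a -> key a < key c -> T U y a c) -> le x y.
Proof.
move=> sx bx H; apply: le_of_descents => c a p q ad h1 h2 h3 h4 h5.
have ac : key a < key c by lia.
apply: (H c a ad ac); rewrite /Treq h1 h2 h3 /=; have nc := bx _ _ ad ac.
apply/andP; split.
  case: (eqVneq p a) => //= pa; apply: contraT => Up.
  have := @ncontr_pos x c a p sx ad; rewrite (negbTE Up) => /(_ _ _ nc) h.
  have : pos x p < pos x c by apply: h; move: pa; rewrite ?eq_key; lia.
  by move/eqP: ad; lia.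
case: (eqVneq q c) => //= qc; apply/negP => Uq.
have := @ncontr_pos x c a q sx ad; rewrite Uq => /(_ _ _ nc) h.
have : pos x a < pos x q by apply: h; move: qc; rewrite ?eq_key; lia.
by move/eqP: ad; lia.
Qed.

Lemma bottom_ex x : signed x -> exists y, [/\ signed y, bottom U y, le y x & ceq U y x].
Proof.
have [m] := ubnP (ninv x); elim: m x => // m IH x lex sx.
case: (boolP [exists p, [&& adj x p.1 p.2, key p.2 < key p.1 & contr U (x * refl p.1 p.2)%g p.2 p.1]]).
  case/existsP=> [[c a]] /and3P[/= ad ac ct].
  have [y [sy ady E lty ley]] := unswap sx ad ac.
  have Ey : (x * refl c a)%g = y by rewrite E (refl_sym c) refl_sq.
  have [|z [sz bz lz cz]] := IH y _ sy; first by rewrite ltnS in lex; apply: leq_trans lty lex.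
  exists z; split=> //; first exact: le_trans lz ley.
  by apply: ceq_trans cz _; rewrite {1}E; apply: ceq_step; rewrite -?Ey // Ey.
move/existsPn=> H; exists x; split=> //; last exact: ceq_refl.
by move=> c a ad ac; have := H (c, a); rewrite /= ad ac.
Qed.

Lemma ceq_of_T x y : signed x -> signed y -> (forall a c, T U x a c <-> T U y a c) -> ceq U x y.
Proof.
move=> sx sy H.
have [x' [sx' bx' _ cx]] := bottom_ex sx; have [y' [sy' by' _ cy]] := bottom_ex sy.
have TT a c : T U x' a c <-> T U y' a c by rewrite (ceqT cx) (ceqT cy).
have E : x' = y'.
  apply: le_anti; apply: le_of_T => // c a ad ac.
    by apply/TT; apply: bottom_T ad ac.
  by apply/TT; apply: bottom_T ad ac.
by apply: ceq_trans (ceq_sym cx) _; rewrite E.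
Qed.

(** Each descent of the bottom [b] of the class of [m1] gives a [T] that holds at [m1], hence at [x]
    and [z], hence at [y]. So [b] lies below [y] and [z], thus below [m2], and every [T] of [m1]
    passes to [m2]. *)
Lemma ceq_meet x y z m1 m2 : signed z -> ceq U x y ->
  is_meet x z m1 -> is_meet y z m2 -> ceq U m1 m2.
Proof.
move=> sz cxy; have [sx sy] := ceq_signed cxy.
case/(is_meetP _ sx sz)=> sm1 mx1 mz1 H1; case/(is_meetP _ sy sz)=> sm2 my2 mz2 H2.
apply: ceq_of_T => // a c.
suff W u v m m' : signed v -> signed m -> ceq U u v -> le m u -> le m z ->
    (forall k, signed k -> le k v -> le k z -> le k m') -> T U m a c -> T U m' a c.
  by split; [apply: (W x y)|apply: (W y x)] => //; apply: ceq_sym.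
move=> sv sm cuv mu mz H; have [b [sb bb _ cb]] := bottom_ex sm.
rewrite -(ceqT cb); apply: T_mono; apply: H => //; apply: le_of_T => // c' a' ad ac;
  have Tb := bottom_T sb bb ad ac.
  by apply/(ceqT cuv)/(T_mono mu)/(ceqT cb).
by apply/(T_mono mz)/(ceqT cb).
Qed.
End Cong.

(** * Compatibility with joins, by duality *)

Lemma dual_refl n (x : {perm sgn n}) a c : (dual (x * refl a c) = dual x * refl a c)%g.
Proof.
rewrite /dual -!mulgA; congr (_ * _)%g; apply/permP=> u; rewrite !permM !negpE.
by rewrite refl_signed.
Qed.

Lemma ceq_dual n (U : pred (sgn n)) x y :
  ceq U x y -> ceq (predC U) (dual x) (dual y).
Proof.
elim=> [{}x sx|{}x a c sx ad ac ct|{}x {}y _ IH|{}y {}x z _ IH1 _ IH2].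
- exact/ceq_refl/dual_signed.
- have sy := adj_signed_swap a c sx; have ady := adj_swap sx ad.
  have -> : dual x = (dual (x * refl a c) * refl a c)%g by rewrite -dual_refl refl_sq.
  apply: ceq_sym; apply: ceq_step => //; first exact: dual_signed.
    move/eqP: ady; rewrite /adj; have := pos_dual a sy; have := pos_dual c sy; lia.
  case/existsP: ct => b /and3P[ab bc Hb]; apply/existsP; exists b; rewrite ab bc /=.
  have ba : b != a by rewrite eq_key; lia.
  have bc' : b != c by rewrite eq_key; lia.
  have [E1 _ E3 _] := swap_rel sx ad ba bc'.
  by have := pos_dual a sy; have := pos_dual b sy; move: E1 E3 Hb; case: (U b) => /=; lia.
- exact: ceq_sym.
exact: ceq_trans IH1 IH2.
Qed.

Lemma ceq_join n (U : pred (sgn n)) x y z j1 j2 : (forall a, U (negT a) = ~~ U a) ->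
  signed z -> ceq U x y -> is_join x z j1 -> is_join y z j2 -> ceq U j1 j2.
Proof.
move=> UN sz cxy H1 H2; have [sx sy] := ceq_signed cxy.
have M : ceq (predC U) (dual j1) (dual j2).
  apply: (@ceq_meet _ (predC U) _ (dual x) (dual y) (dual z)).
  - by move=> a /=; rewrite UN.
  - exact: dual_signed.
  - exact: ceq_dual.
  - exact: is_join_dual.
  exact: is_join_dual.
(* The double complement of [U] agrees with [U] pointwise, so the relation is transported by
   induction. *)
have := ceq_dual M; rewrite !dualK; elim=> [u su|u a c su ad ac ct|u v _ IH|v u w _ IH1 _ IH2].
- exact: ceq_refl.
- apply: ceq_step => //; case/existsP: ct => b Hb; apply/existsP; exists b.
  by move: Hb; rewrite /= negbK.
- exact: ceq_sym.
exact: ceq_trans IH1 IH2.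
Qed.

Lemma ceq_cong n (U : pred (sgn n)) : (forall a, U (negT a) = ~~ U a) -> lat_cong (ceq U).
Proof.
move=> UN; split; first exact: ceq_signed.
split; first exact: ceq_refl.
split; first exact: ceq_sym.
split; first by move=> x y z; apply: ceq_trans.
split; first by move=> x y z j1 j2; apply: ceq_join.
by move=> x y z m1 m2; apply: ceq_meet.
Qed.

(** * The fibers of [etaB] *)

Definition upS n (up : nat -> bool) : pred (sgn n) := fun a => upV up (tv a).

Lemma upSN n (up : nat -> bool) (a : sgn n) : upS up (negT a) = ~~ upS up a.
Proof. by case: a => [[] i]; rewrite /upS /upV /= ltn_ord ?negbK. Qed.

(** The ends of [Q] have ranks 0 and [2n + 1], so the vertex of a value has rank one more than the
    [key] of the value. *)
Definition vkey n (v : vtx n) : nat := @key n.+1 v.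

Lemma vkey_inj n : injective (@vkey n).
Proof. exact: key_inj. Qed.

Lemma ltn_vval n (u v : vtx n) : (vval u < vval v)%R = (vkey u < vkey v).
Proof.
by case: u v => [[] i] [[] j]; rewrite /vval /vkey /key /=;
  have := ltn_ord i; have := ltn_ord j; lia.
Qed.

Lemma vkey_tv n (a : sgn n) : vkey (tv a) = (key a).+1.
Proof. by case: a => [[] i]; rewrite /vkey /key /=; have := ltn_ord i; lia. Qed.

Lemma vtxP n (v : vtx n) : val v.2 = n \/ exists a : sgn n, v = tv a.
Proof.
case: v => s i; case: (ltnP (val i) n) => H; last first.
  by left; apply/eqP; rewrite /= eqn_leq H andbT -ltnS ltn_ord.
right; exists (s, Ordinal H); congr pair; exact: val_inj.
Qed.

Lemma tv_in n (a : sgn n) : (val (tv a).2 == n) = false.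
Proof. by apply/negbTE; rewrite /tv /= neq_ltn ltn_ord. Qed.

Lemma pedgesP n (L : {set vtx n}) (p : vtx n * vtx n) :
  reflect [/\ p.1 \in L, p.2 \in L, vkey p.1 < vkey p.2 &
     forall c, c \in L -> vkey p.1 < vkey c -> vkey p.2 <= vkey c] (p \in pedges L).
Proof.
rewrite inE ltn_vval; apply: (iffP and4P) => [[-> -> -> /forallP H]|[-> -> -> H]]; split=> //.
  by move=> c cL h; move: (H c); rewrite cL !ltn_vval h -leqNgt.
by apply/forallP=> c; apply/implyP=> /H h; rewrite !ltn_vval negb_and -!leqNgt; case: ltnP => // /h ->.
Qed.

Definition lam n (up : nat -> bool) (x : {perm sgn n}) k : {set vtx n} :=
  foldl (step up) (lower n up) (take k (fullnot x)).

Definition fullpos n : seq (sgn n) :=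
  [seq (true, i) | i <- rev (enum 'I_n)] ++ [seq (false, i) | i <- enum 'I_n].

Lemma fullnotE n (x : {perm sgn n}) : fullnot x = [seq x a | a <- fullpos n].
Proof. by rewrite /fullnot /fullpos map_cat -!map_comp. Qed.

Lemma size_fullpos n : size (fullpos n) = n.*2.
Proof. by rewrite size_cat !size_map size_rev -enumT size_enum_ord addnn. Qed.

Lemma key_nth_fullpos n a0 k : k < n.*2 -> key (nth a0 (fullpos n) k) = k.
Proof.
move=> lt_k; have n0 : 0 < n by lia.
pose i0 := Ordinal n0; rewrite nth_cat size_map size_rev size_enum_ord.
case: ltnP => H.
  rewrite (nth_map i0) ?size_rev ?size_enum_ord // nth_rev ?size_enum_ord //.
  by rewrite /key /= nth_enum_ord; lia.
rewrite (nth_map i0) ?size_enum_ord; last lia.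
by rewrite /key /= nth_enum_ord; lia.
Qed.

(** The full notation lists each value once, so only its own step changes the membership of its
    vertex. *)
Lemma lamE n up (x : {perm sgn n}) k a :
  (tv a \in lam up x k) = if upS up a then pos x a < k else k <= pos x a.
Proof.
have tvi : injective (@tv n) by move=> u v /(congr1 (@vkey n)); rewrite !vkey_tv => -[/key_inj].
elim: k => [|k IH].
  by rewrite /lam take0 /= inE tv_in /= /downV /upS; case: (upV up (tv a)); rewrite ?andbF //= ltn_ord.
(* Past the last entry [take] returns the whole word and the path no longer changes. *)
case: (ltnP k n.*2) => lt_k; last first.
  rewrite /lam take_oversize; last by rewrite fullnotE size_map size_fullpos; lia.
  move: IH; rewrite /lam take_oversize; last by rewrite fullnotE size_map size_fullpos.
  by move->; have := pos_lt x a; case: (upS up a); lia.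
have [b kb] := key_surj lt_k.
rewrite /lam (take_nth b) ?fullnotE ?size_map ?size_fullpos // -fullnotE foldl_rcons -/(lam up x k).
rewrite fullnotE (nth_map b) ?size_fullpos //.
have -> : nth b (fullpos n) k = b by apply: key_inj; rewrite key_nth_fullpos.
have pb : pos x (x b) = k by rewrite /pos permK.
rewrite /step -/(upS up (x b)); case: (eqVneq a (x b)) => [->|ab].
  by rewrite pb; case: (upS up (x b)); rewrite !inE eqxx //= ?ltnSn ?ltnn.
have -> : (tv a \in (if upS up (x b) then tv (x b) |: lam up x k else lam up x k :\ tv (x b)))
    = (tv a \in lam up x k) by case: ifP; rewrite !inE (inj_eq tvi) (negbTE ab).
by rewrite IH; move: ab; rewrite (eq_pos x) pb; case: (upS up a); lia.
Qed.

Lemma end_in_lam n up (x : {perm sgn n}) k v : val v.2 = n -> v \in lam up x k.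
Proof.
move=> Hv; have : v \in lower n up by rewrite inE Hv eqxx.
rewrite /lam; elim: (take k _) (lower n up) => //= a s IH L vL; apply: IH.
have va : v != tv a by apply/eqP=> E; move: (tv_in a); rewrite -E Hv eqxx.
by rewrite /step; case: ifP => _; rewrite !inE vL ?va ?orbT.
Qed.

Lemma etaBP n up (x : {perm sgn n}) p :
  reflect (isdiag up p /\ exists k, p \in pedges (lam up x k)) (p \in etaB up x).
Proof.
rewrite inE; apply: (iffP andP) => -[dp H]; split=> //.
  case/orP: H => [H|/(has_nthP (lower n up)) [k]]; first by exists 0; rewrite /lam take0.
  by rewrite size_scanl => Hk; rewrite nth_scanl // => H; exists k.+1.
have sz : size (fullnot x) = n.*2 by rewrite fullnotE size_map size_fullpos.
have {H} [k lek H] : exists2 k, k <= n.*2 & p \in pedges (lam up x k).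
  case: H => k H; case: (leqP k n.*2) => Hk; first by exists k.
  by exists n.*2 => //; move: H; rewrite /lam !take_oversize ?sz // ltnW.
rewrite /lambdas; case: k lek H => [|k] lek H /=; first by move: H; rewrite /lam take0 => ->.
apply/orP; right; apply/(has_nthP (lower n up)); exists k; first by rewrite size_scanl sz.
by rewrite nth_scanl ?sz.
Qed.

(* A vertex lying on the path cuts it into two independent halves. *)
Lemma pedges_split n (A B C : {set vtx n}) b p :
  b \in A -> b \in B -> b \in C ->
  (forall v, vkey v <= vkey b -> (v \in A) = (v \in B)) ->
  (forall v, vkey b <= vkey v -> (v \in A) = (v \in C)) ->
  p \in pedges A -> p \in pedges B \/ p \in pedges C.
Proof.
case: p => u w bA bB bC AB AC /pedgesP[/= p1 p2 p12 H].
case: (leqP (vkey w) (vkey b)) => Hb.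
  have Hb1 : vkey u <= vkey b by lia.
  left; apply/pedgesP; split=> /=; rewrite -1?AB //.
  move=> c cB pc; case: (leqP (vkey c) (vkey b)) => h; last lia.
  by apply: H => //; rewrite AB.
have Hb' : vkey b <= vkey u.
  by rewrite leqNgt; apply/negP => h; have := H _ bA h; lia.
have Hb1 : vkey b <= vkey w by lia.
right; apply/pedgesP; split=> /=; rewrite -1?AC //.
by move=> c cC pc; apply: H => //; rewrite AC //; lia.
Qed.

Section Eta.
Variables (n : nat) (up : nat -> bool).
Implicit Types x y : {perm sgn n}.
Local Notation U := (@upS n up).

Lemma lam_eq x y k k' v : (forall a, v = tv a -> (pos x a < k) = (pos y a < k')) ->
  (v \in lam up x k) = (v \in lam up y k').
Proof.
case: (vtxP v) => [Hv _|[a ->] /(_ a erefl) H]; first by rewrite !end_in_lam.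
rewrite (lamE up x) (lamE up y) (leqNgt k) (leqNgt k').
by case: (upS up a); [exact: H | congr (~~ _); exact: H].
Qed.

Lemma swap_other x a c k v : signed x -> adj x a c ->
  k != (pos x a).+1 -> k != (pos x (negT c)).+1 ->
  (pos (x * refl a c)%g v < k) = (pos x v < k).
Proof.
move=> sx ad k1 k2; have ac : a != c by rewrite (eq_pos x); move/eqP: ad; lia.
rewrite pos_swap //; have := pos_neg a sx; have := pos_neg c sx; move/eqP: ad.
by do ?[case: eqP => ?]; lia.
Qed.

(** Around this pair only the path between the two processing steps changes. The vertex of [b] lies
    on all paths involved: to its left the middle path of [x] agrees with the path of [y] after both
    steps, to its right with the one before both. For the middle path of [y] the sides are
    exchanged. *)
Lemma swap_mid x a c b p : signed x -> adj x a c ->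
  key a < key b -> key b < key c -> (if U b then pos x b < pos x a else pos x a < pos x b) ->
  forall y k, y = (x * refl a c)%g -> k = (pos x a).+1 ->
  (p \in pedges (lam up x k) -> exists k', p \in pedges (lam up y k')) /\
  (p \in pedges (lam up y k) -> exists k', p \in pedges (lam up x k')).
Proof.
move=> sx ad ab bc Hb y k Ey Ek.
have ba : b != a by rewrite eq_key; lia.
have bc' : b != c by rewrite eq_key; lia.
have ac : a != c by rewrite eq_key; lia.
have [E1 E2 E3 E4] := swap_rel sx ad ba bc'; rewrite -Ey in E1 E2 E3 E4.
have ady : adj y c a by rewrite Ey; apply: adj_swap.
have yc : pos y c = pos x a by rewrite Ey pos_swap // eqxx eq_sym -(eq_pos x) (negbTE ac).
move/eqP: (ad) => ad'; move/eqP: (ady) => ady'.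
have other v k1 k2 : v != a -> v != c -> k.-1 <= k1 -> k1 <= k.+1 -> k.-1 <= k2 -> k2 <= k.+1 ->
    (pos x v < k1) = (pos y v < k2).
  move=> va vc; have [E _ _ _] := swap_rel sx ad va vc.
  move: E va (va) vc (vc); rewrite -Ey {1}(eq_pos x) {1}(eq_pos y) {1}(eq_pos x) {1}(eq_pos y).
  rewrite ady' yc ad' Ek /=; clear; lia.
have lo u : key u <= key b -> (pos x u < k) = (pos y u < k.+1) /\ (pos y u < k) = (pos x u < k.-1).
  move=> leu; have uc : u != c by rewrite eq_key; lia.
  case: (eqVneq u a) => [->|ua]; first by rewrite ady' yc Ek /=; lia.
  by split; [apply: other|apply/esym/other] => //; rewrite Ek; clear; lia.
have hi u : key b <= key u -> (pos x u < k) = (pos y u < k.-1) /\ (pos y u < k) = (pos x u < k.+1).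
  move=> leu; have ua : u != a by rewrite eq_key; lia.
  case: (eqVneq u c) => [->|uc]; first by rewrite yc ad' Ek /=; lia.
  by split; [apply: other|apply/esym/other] => //; rewrite Ek; clear; lia.
have [k1 k2 k3] : [/\ k.-1 <= k.-1, k.-1 <= k & k <= k.+1] by rewrite Ek; split; lia.
have A3 := adj_aft ad ba bc'.
have mid j : k.-1 <= j -> j <= k.+1 -> tv b \in lam up x j /\ tv b \in lam up y j.
  move=> l1 l2; rewrite !lamE; move: E2 E3 A3 Hb; rewrite ady' yc ad'.
  by move: l1 l2; rewrite Ek; clear; case: (upS up b); lia.
have [inA inB] := mid _ k2 k3; have [inC inD] := mid _ k1 (leq_trans k2 k3).
have [inE inF] := mid _ (leq_trans k2 k3) (leqnn _).
have lek u v w : v = tv u -> vkey v <= vkey (tv w) -> key u <= key w by move=> ->; rewrite !vkey_tv.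
have gek u v w : v = tv u -> vkey (tv w) <= vkey v -> key w <= key u by move=> ->; rewrite !vkey_tv.
split=> H.
  have [||h|h] := @pedges_split _ _ (lam up y k.+1) (lam up y k.-1) (tv b) p inA inF inD _ _ H.
  - by move=> v lev; apply: lam_eq => u E; apply: (lo u _).1; apply: lek E lev.
  - by move=> v lev; apply: lam_eq => u E; apply: (hi u _).1; apply: gek E lev.
  - by exists k.+1.
  by exists k.-1.
have [||h|h] := @pedges_split _ _ (lam up x k.-1) (lam up x k.+1) (tv b) p inB inC inE _ _ H.
- by move=> v lev; apply: lam_eq => u E; apply: (lo u _).2; apply: lek E lev.
- by move=> v lev; apply: lam_eq => u E; apply: (hi u _).2; apply: gek E lev.
- by exists k.-1.
by exists k.+1.
Qed.

Lemma eta_step x a c : signed x -> adj x a c -> key a < key c -> contr U x a c ->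
  etaB up x = etaB up (x * refl a c)%g.
Proof.
move=> sx ad ac ct; set y := (x * refl a c)%g.
have ad' : adj x (negT c) (negT a) by rewrite adj_neg.
have ct' := contr_neg (@upSN n up) sx ad ct.
have Ey : y = (x * refl (negT c) (negT a))%g by rewrite refl_neg refl_sym.
(* The pair and its mirror image each change one path, so each comes with its own witness. *)
have /existsP[b /and3P[h1 h2 h3]] := ct; have /existsP[b' /and3P[h1' h2' h3']] := ct'.
have K p := @swap_mid x a c b p sx ad h1 h2 h3 _ _ erefl erefl.
have K' p := @swap_mid x (negT c) (negT a) b' p sx ad' h1' h2' h3' _ _ erefl erefl.
apply/setP=> p; apply/etaBP/etaBP => -[dp [k H]]; split=> //.
  case: (eqVneq k (pos x a).+1) => [E|k1]; first by apply: (K p).1; rewrite -E.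
  case: (eqVneq k (pos x (negT c)).+1) => [E|k2]; first by rewrite Ey; apply: (K' p).1; rewrite -E.
  exists k; suff <- : lam up x k = lam up y k by [].
  by apply/setP=> v; apply: lam_eq => u _; rewrite swap_other.
case: (eqVneq k (pos x a).+1) => [E|k1]; first by apply: (K p).2; rewrite -E.
case: (eqVneq k (pos x (negT c)).+1) => [E|k2]; first by apply: (K' p).2; rewrite -E -Ey.
exists k; suff -> : lam up x k = lam up y k by [].
by apply/setP=> v; apply: lam_eq => u _; rewrite swap_other.
Qed.

Lemma eta_ceq x y : ceq U x y -> etaB up x = etaB up y.
Proof.
elim=> // [{}x a c sx ad ac ct|{}y {}x z _ -> _ //].
exact: eta_step.
Qed.

(** When [c] has been processed and [a] has not, no vertex strictly between them is on the path of
    [x], so an edge spans the gap. If it also occurs for [y], then at that moment [c] and the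
    intermediate down values are processed while [a] and the intermediate up values are not: these
    are the inversions in [T]. *)
Lemma eta_T x y c a : signed x -> adj x c a -> key a < key c ->
  ~~ contr U (x * refl c a)%g a c -> {subset etaB up x <= etaB up y} -> T U y a c.
Proof.
move=> sx ad ac nc sub; have [k Ek] : exists k, k = pos x a by exists (pos x a).
have /eqP ad' := ad; rewrite -Ek in ad'.
have betw b : key a < key b -> key b < key c -> tv b \notin lam up x k.
  move=> ab bc; have := ncontr_pos sx ad ab bc nc; rewrite lamE -/(upS up b).
  by case: (U b); mlia.
have aL : (tv a \in lam up x k) = ~~ U a by rewrite lamE -/(upS up a) Ek leqnn ltnn; case: (U a).
have cL : (tv c \in lam up x k) = U c by rewrite lamE -/(upS up c) ad' ltnSn leqNgt ltnSn; case: (U c).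
have keyE (s : bool) : vkey ((s, ord_max) : vtx n) = if s then 0 else n.*2.+1.
  by rewrite /vkey /key /=; case: s; mlia.
(* The ends of [Q] lie on every path, so nearest path vertices [a1] and [c1] on either side of the
   gap exist. *)
have [a1 /andP[a1L lea1] maxa1] : exists2 v, (v \in lam up x k) && (vkey v <= vkey (tv a)) &
    forall w, w \in lam up x k -> vkey w <= vkey (tv a) -> vkey w <= vkey v.
  case: (@arg_maxnP _ ((true, ord_max) : vtx n)
    (fun v => (v \in lam up x k) && (vkey v <= vkey (tv a))) (@vkey n)).
    by rewrite end_in_lam //= keyE.
  by move=> v Hv H; exists v => // w w1 w2; apply: H; rewrite w1 w2.
have [c1 /andP[c1L lec1] minc1] : exists2 v, (v \in lam up x k) && (vkey (tv c) <= vkey v) &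
    forall w, w \in lam up x k -> vkey (tv c) <= vkey w -> vkey v <= vkey w.
  case: (@arg_minnP _ ((false, ord_max) : vtx n)
    (fun v => (v \in lam up x k) && (vkey (tv c) <= vkey v)) (@vkey n)).
    by rewrite end_in_lam //= keyE vkey_tv ltnW // ltnS key_lt.
  by move=> v Hv H; exists v => // w w1 w2; apply: H; rewrite w1 w2.
rewrite !vkey_tv in lea1 lec1.
have edge : (a1, c1) \in pedges (lam up x k).
  apply/pedgesP; split=> //=; first mlia.
  move=> v vL lt_v; case: (leqP (vkey v) (key a).+1) => h1.
    by have := maxa1 v vL; rewrite vkey_tv => /(_ h1); rewrite leqNgt lt_v.
  case: (leqP (key c).+1 (vkey v)) => h2; first by apply: minc1; rewrite ?vkey_tv.
  case: (vtxP v) => [Hv|[b E]].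
    have : vkey v = 0 \/ vkey v = n.*2.+1.
      rewrite /vkey /key; case: (v) Hv => -[] i /= ->; mlia.
    by have := key_lt c; mlia.
  move: h1 h2; rewrite E !vkey_tv => h1 h2.
  by have := betw b; rewrite -E vL; mlia.
have a1a : a1 != tv a -> vkey a1 < (key a).+1.
  by rewrite -(inj_eq (@vkey_inj n)) vkey_tv ltn_neqAle lea1 andbT.
have c1c : c1 != tv c -> (key c).+1 < vkey c1.
  by rewrite -(inj_eq (@vkey_inj n)) vkey_tv eq_sym ltn_neqAle lec1 andbT.
(* On the upper boundary, [a] would have to be up; being unprocessed it is off the path, so its
   vertex would lie strictly inside the edge. The lower boundary is excluded in the same way with
   [c]. *)
have dg : isdiag up (a1, c1).
  rewrite /isdiag ltn_vval /=; apply/and3P; split; first mlia.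
    apply/negP => /pedgesP[/= h1 h2 h3 h4].
    case: (eqVneq a1 (tv a)) => [E|ne].
      have Ua : U a by move: h1; rewrite E inE tv_in.
      by move: a1L; rewrite E aL Ua.
    have Ua : U a.
      apply: contraR ne => Ua; have := maxa1 (tv a); rewrite aL Ua leqnn vkey_tv => /(_ isT isT) h.
      by rewrite -(inj_eq (@vkey_inj n)) vkey_tv eqn_leq ?lea1 ?lec1 ?h.
    have := h4 (tv a); rewrite inE tv_in -/(upS up a) -/(upS up a) Ua vkey_tv => /(_ isT (a1a ne)); mlia.
  apply/negP => /pedgesP[/= h1 h2 h3 h4].
  have dE u : downV up (tv u) = ~~ U u by rewrite /downV /upS /= ltn_ord.
  case: (eqVneq c1 (tv c)) => [E|ne].
    have Uc : ~~ U c by move: h2; rewrite E inE tv_in dE.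
    by move: c1L; rewrite E cL (negbTE Uc).
  have Uc : ~~ U c.
    apply: contra ne => Uc; have := minc1 (tv c); rewrite cL Uc leqnn vkey_tv => /(_ isT isT) h.
    by rewrite -(inj_eq (@vkey_inj n)) vkey_tv eqn_leq ?lea1 ?lec1 ?h.
  have := h4 (tv c); rewrite inE tv_in dE Uc vkey_tv => /(_ isT); have := c1c ne; mlia.
have /sub/etaBP[_ [k' /pedgesP[/= h1 h2 h3 h4]]] : (a1, c1) \in etaB up x.
  by apply/etaBP; split=> //; exists k.
have out b : vkey a1 < (key b).+1 -> (key b).+1 < vkey c1 -> tv b \notin lam up y k'.
  by move=> l1 l2; apply/negP => /h4; rewrite vkey_tv => /(_ l1); mlia.
have Ya : k' <= pos y a.
  case: (eqVneq a1 (tv a)) => [E|ne].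
    by move: a1L h1; rewrite E aL lamE -/(upS up a) => /negbTE ->.
  have Ua : U a.
    apply: contraR ne => Ua; have := maxa1 (tv a); rewrite aL Ua leqnn vkey_tv => /(_ isT isT) h.
    by rewrite -(inj_eq (@vkey_inj n)) vkey_tv eqn_leq ?lea1 ?lec1 ?h.
  by have := out a (a1a ne); rewrite lamE -/(upS up a) Ua -leqNgt; apply; mlia.
have Yc : pos y c < k'.
  case: (eqVneq c1 (tv c)) => [E|ne].
    by move: c1L h2; rewrite E cL lamE -/(upS up c) => ->.
  have Uc : ~~ U c.
    apply: contra ne => Uc; have := minc1 (tv c); rewrite cL Uc leqnn vkey_tv => /(_ isT isT) h.
    by rewrite -(inj_eq (@vkey_inj n)) vkey_tv eqn_leq ?lea1 ?lec1 ?h.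
  have := out c; rewrite lamE -/(upS up c) (negbTE Uc) -ltnNge; apply; [mlia|exact: c1c].
move=> p q /and5P[g1 g2 g3 g4 g5]; rewrite /inv g2 /=.
have Yp : k' <= pos y p.
  case: (eqVneq p a) g4 => [->//|pa /= Up].
  have := out p; rewrite lamE -/(upS up p) Up -leqNgt; apply; first by move: pa; rewrite eq_key; mlia.
  mlia.
have Yq : pos y q < k'.
  case: (eqVneq q c) g5 => [->//|qc /= Uq].
  have := out q; rewrite lamE -/(upS up q) (negbTE Uq) -ltnNge; apply; first mlia.
  by move: qc; rewrite eq_key; mlia.
mlia.
Qed.

Lemma etaP x y : signed x -> signed y -> etaB up x = etaB up y <-> ceq U x y.
Proof.
move=> sx sy; split=> [E|]; last exact: eta_ceq.
have [x' [sx' bx' _ cx]] := @bottom_ex _ U _ sx; have [y' [sy' by' _ cy]] := @bottom_ex _ U _ sy.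
have E' : etaB up x' = etaB up y' by rewrite (eta_ceq cx) (eta_ceq cy).
have Exy : x' = y'.
  apply: le_anti.
    apply: (le_of_T sx' bx') => c a ad ac.
    by apply: (eta_T sx' ad ac (bx' _ _ ad ac)); rewrite E'.
  apply: (le_of_T sy' by') => c a ad ac.
  by apply: (eta_T sy' ad ac (by' _ _ ad ac)); rewrite E'.
by apply: ceq_trans (ceq_sym cx) _; rewrite Exy.
Qed.
End Eta.

(** * The Cambrian generators *)

Section Gens.
Variables (n : nat) (up : nat -> bool) (i j : 'I_n).
Hypothesis ij : val j = (val i).+1.
Notation A := (ps i).
Notation B := ((false, i) : sgn n).
Notation C := ((false, j) : sgn n).

Lemma ps_succ : ps j = B.
Proof.
rewrite /ps ij /=; congr pair; apply: val_inj; rewrite /predo val_insubd.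
by move: ij; case: ifP => /=; have := ltn_ord j; lia.
Qed.

Lemma key_AB : key B = (key A).+1. Proof. exact: key_ps. Qed.
Lemma key_BC : key C = (key B).+1. Proof. by rewrite key_ps ps_succ. Qed.

Lemma AB_neg : (A == negT B) = (val i == 0).
Proof. by rewrite /ps; case: ifP => H; rewrite ?eqxx // eq_key /key /= ; have := ltn_ord i; lia. Qed.

Lemma neg_AB : val i != 0 -> negT B != A /\ negT A != B.
Proof.
rewrite -AB_neg => H; split; first by rewrite eq_sym.
by apply: contra H => /eqP E; rewrite -[A]negTK E.
Qed.

Lemma key_B : n <= key B. Proof. by rewrite /key /= leq_addr. Qed.

Lemma inv_gen (t : 'I_n) p q :
  inv (gen t) p q = (p == ps t) && (q == (false, t)) || (p == (true, t)) && (q == negT (ps t)).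
Proof.
have [E ad] := gen_mul t (@signed1 n); rewrite !perm1 mulg1 mul1g in E ad.
by rewrite E -[refl _ _]mul1g inv_swap ?inv1 // ?key_ps //; exact: signed1.
Qed.

Lemma gen_l (t : 'I_n) : gen t (ps t) = (false, t).
Proof. by rewrite genE reflE ?eqxx // eq_key key_ps; lia. Qed.

Lemma gen_r (t : 'I_n) : gen t (false, t) = ps t.
Proof. by rewrite genE refl_sym reflE ?eqxx // eq_key key_ps; lia. Qed.

Lemma gen_other (t : 'I_n) u : [&& u != ps t, u != (false, t), u != negT (ps t) & u != (true, t)] ->
  gen t u = u.
Proof.
case/and4P=> h1 h2 h3 h4; rewrite genE reflE; last by rewrite eq_key key_ps; lia.
by rewrite (negbTE h1) (negbTE h2) (negbTE h3) (negbTE h4).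
Qed.

Lemma ceq_gen_step (x : {perm sgn n}) t b (U := @upS n up) : signed x ->
  key (x (ps t)) < key b -> key b < key (x (false, t)) ->
  (if U b then pos x b < key (ps t) else key (false, t) < pos x b) ->
  ceq U x (gen t * x)%g.
Proof.
move=> sx h1 h2 h3; have [-> ad] := gen_mul t sx; apply: ceq_step => //; first by lia.
apply/existsP; exists b; rewrite h1 h2 /=.
have -> : pos x (x (ps t)) = key (ps t) by rewrite /pos permK.
by move: h3; rewrite key_ps -/(U b); case: (U b) => //; apply: ltn_trans.
Qed.

Lemma posE (x : {perm sgn n}) a b : x a = b -> pos x b = key a.
Proof. by move=> <-; rewrite /pos permK. Qed.

Lemma gen_i_C : gen i C = C.
Proof.
apply: gen_other; rewrite !eq_key; have := key_AB; have := key_BC; have := key_B.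
by have := key_neg A; have := key_neg B; have := key_lt C; rewrite -[(true, i)]/(negT B); lia.
Qed.

Lemma gen_j_A : val i != 0 -> gen j A = A.
Proof.
move=> i0; apply: gen_other; rewrite ps_succ !eq_key; have [h1 h2] := neg_AB i0.
move: h1 h2; rewrite !eq_key.
have := key_AB; have := key_BC; have := key_B.
by have := key_neg A; have := key_neg B; have := key_neg C; rewrite -[(true, j)]/(negT C); lia.
Qed.

(** The up value [B] stays first and witnesses every swap: [B A C] becomes [B C A]. For [i = 0] the
    middle runs from [-C B -B C] through [B -C C -B] to [B C -C -B]. *)
Lemma up_chain (U := @upS n up) : U B ->
  [/\ ceq U (gen i) (gen j * gen i)%g, inv (gen j * gen i)%g A C &
   val i = 0 -> ceq U (gen i) (gen i * (gen j * gen i))%g /\ 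
     inv (gen i * (gen j * gen i))%g A C /\ inv (gen i * (gen j * gen i))%g (negT C) C].
Proof.
move=> UB; have kAB := key_AB; have kBC := key_BC; have kB := key_B.
have si := gen_signed i; have sj := gen_signed j; have sji := signedM sj si.
have c1 : ceq U (gen i) (gen j * gen i)%g.
  apply: (@ceq_gen_step _ _ B) => //; rewrite ?ps_succ ?gen_r ?gen_i_C ?kBC ?kAB //.
  by rewrite -/(U B) UB (posE (gen_l i)).
have iAC : inv (gen j * gen i)%g A C.
  have [E ad] := gen_mul j si; move: E ad; rewrite ps_succ gen_r gen_i_C => -> ad.
  by rewrite inv_swap // ?eqxx ?orbT //; lia.
split=> // i0; have EA : A = negT B by apply/eqP; rewrite AB_neg i0.
have xA : (gen j * gen i)%g A = negT C.
  by rewrite permM EA (gen_signed j) -ps_succ gen_l (gen_signed i) gen_i_C.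
have xB : (gen j * gen i)%g B = C by rewrite permM -ps_succ gen_l gen_i_C.
have kC := key_neg C; have kB' := key_neg B.
have ltC : key (negT C) < key C by lia.
have [E ad] := gen_mul i sji; move: E ad; rewrite xA xB => E ad.
split; last by rewrite E !inv_swap // iAC !eqxx orbT.
apply: ceq_trans c1 _; apply: (@ceq_gen_step _ _ B) => //; rewrite ?xA ?xB ?kBC //; first lia.
have -> : pos (gen j * gen i)%g B = key (negT C).
  by apply: posE; rewrite permM sj -ps_succ gen_r ps_succ -EA gen_l.
by rewrite -/(U B) UB EA; lia.
Qed.

(** The down value [B] stays last: [A C B] becomes [C A B]. For [i = 0] the middle runs from
    [-B -C C B] through [-B C -C B] to [C -B B -C], and the last swap is witnessed by the up value
    [-B]. *)
Lemma down_chain (U := @upS n up) : ~~ U B ->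
  [/\ ceq U (gen j) (gen i * gen j)%g, val i != 0 -> inv (gen i * gen j)%g A C &
   val i = 0 -> ceq U (gen j) (gen j * (gen i * gen j))%g /\ 
     inv (gen j * (gen i * gen j))%g A C /\ inv (gen j * (gen i * gen j))%g (negT C) C].
Proof.
move=> UB; have kAB := key_AB; have kBC := key_BC; have kB := key_B.
have kC := key_neg C; have kB' := key_neg B.
have si := gen_signed i; have sj := gen_signed j; have sij := signedM si sj.
have jB : gen j B = C by rewrite -ps_succ gen_l.
have jC : gen j C = B by rewrite gen_r ps_succ.
have j0A : val i = 0 -> gen j A = negT C.
  by move=> i0; have /eqP -> : A == negT B; rewrite ?AB_neg ?i0 // sj jB.
have ltA : key (gen j A) < key B.
  by case: (eqVneq (val i) 0) => [/j0A->|/gen_j_A->]; lia.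
have c1 : ceq U (gen j) (gen i * gen j)%g.
  apply: (@ceq_gen_step _ _ B) => //; rewrite ?jB ?kBC //.
  by rewrite -/(U B) (negbTE UB) (posE jC) kBC.
have [E ad] := gen_mul i sj; rewrite jB in E ad.
split=> // [i0|i0].
  move: E ad; rewrite gen_j_A // => -> ad.
  by rewrite inv_swap // ?eqxx ?orbT //; lia.
have EA : A = negT B by apply/eqP; rewrite AB_neg i0.
rewrite j0A // in E ad; have ltC : key (negT C) < key C by lia.
have iCC : inv (gen i * gen j)%g (negT C) C by rewrite E inv_swap // !eqxx orbT.
have xB : (gen i * gen j)%g B = negT C by rewrite permM gen_r j0A.
have xC : (gen i * gen j)%g C = B by rewrite permM gen_i_C jC.
have [E' ad'] := gen_mul j sij; move: E' ad'; rewrite ps_succ xB xC => E' ad'.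
have ltCB : key (negT C) < key B by lia.
split; last by rewrite E' !inv_swap // iCC EA !eqxx ?negTK !orbT.
apply: ceq_trans c1 _; apply: (@ceq_gen_step _ _ (negT B)) => //; rewrite ?ps_succ ?xB ?xC; try lia.
have -> : upS up (negT B) by rewrite upSN.
have -> : pos (gen i * gen j)%g (negT B) = key (negT C) by apply: posE; rewrite sij xC.
lia.
Qed.

Definition gword (s t : 'I_n) := wprod (altword t s (mst s t).-1).

Lemma gwordE (s t : 'I_n) :
  gword s t = if (val s == 0) || (val t == 0) then (gen t * (gen s * gen t))%g
              else (gen s * gen t)%g.
Proof.
by rewrite /gword /mst; case: ifP => _; rewrite /wprod /= /Defs.comp mul1g ?mulgA.
Qed.

Lemma arrow_up (U := @upS n up) : U B -> [/\ arrow up j i, ceq U (gen i) (gword j i),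
   inv (gword j i) A C & val i = 0 -> inv (gword j i) (negT C) C].
Proof.
move=> UB; have [c1 i1 H] := up_chain UB; rewrite gwordE ij /=.
have ar : arrow up j i.
  exists (val j); rewrite ltn_ord ij /=; split=> //; left; split=> //.
  by move: UB; rewrite /U /upS /upV /= ltn_ord.
by case: eqP => i0; split=> //; have [] := H i0 => ? [].
Qed.

Lemma arrow_down (U := @upS n up) : ~~ U B -> [/\ arrow up i j, ceq U (gen j) (gword i j),
   inv (gword i j) A C & val i = 0 -> inv (gword i j) (negT C) C].
Proof.
move=> UB; have [c1 i1 H] := down_chain UB; rewrite gwordE ij orbF.
have ar : arrow up i j.
  exists (val j); rewrite ltn_ord ij /=; split=> //; right; split=> //.
  by move: UB; rewrite /U /upS /upV /= ltn_ord.
by case: eqP => i0; split=> //; [have [] := H i0 => ? []..|apply: i1; apply/eqP].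
Qed.
End Gens.

Lemma arrow_ceq n up (s t : 'I_n) : arrow up s t -> ceq (@upS n up) (gen t) (gword s t).
Proof.
case=> b [/andP[b0 bn] [[Hup [Hs Ht]]|[Hup [Hs Ht]]]].
  have ij : val s = (val t).+1 by rewrite Hs Ht prednK.
  have [|//] := @arrow_up _ up _ _ ij.
  by rewrite /upS /upV /= ltn_ord /= -ij Hs.
have ij : val t = (val s).+1 by rewrite Hs Ht prednK.
have [|//] := @arrow_down _ up _ _ ij.
by rewrite /upS /upV /= ltn_ord /= -ij Ht.
Qed.

(** * Forcing along polygons *)

Lemma le_swap n (x k : {perm sgn n}) a c : signed x -> signed k -> adj x a c -> key a < key c ->
  le x k -> inv k a c -> le (x * refl a c)%g k.
Proof.
move=> sx sk ad ac xk kac u v; rewrite inv_swap // => /or3P[/xk//|/andP[/eqP-> /eqP->]//|].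
by case/andP=> /eqP-> /eqP->; rewrite inv_neg.
Qed.

Lemma le_swapr n (x : {perm sgn n}) a c : signed x -> adj x a c -> key a < key c ->
  le x (x * refl a c)%g.
Proof. by move=> sx ad ac u v h; rewrite inv_swap // h. Qed.

Lemma inv_swapr n (x : {perm sgn n}) a c : signed x -> adj x a c -> key a < key c ->
  inv (x * refl a c)%g a c.
Proof. by move=> sx ad ac; rewrite inv_swap // !eqxx orbT. Qed.

Lemma le_unswap n (x k : {perm sgn n}) a c : signed x -> signed k -> adj x a c -> key a < key c ->
  le k (x * refl a c)%g -> ~~ inv k a c -> le k x.
Proof.
move=> sx sk ad ac ky nk u v h; have := ky u v h; rewrite inv_swap //.
case/or3P=> // /andP[/eqP Eu /eqP Ev]; move: h nk; rewrite Eu Ev ?inv_neg // => -> //.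
Qed.

Lemma adj_ninv n (x : {perm sgn n}) a c : adj x a c -> ~~ inv x a c.
Proof. by move/eqP=> ad; rewrite /inv ad negb_and -!leqNgt leqnSn orbT. Qed.

Lemma adj_key_neq n (x : {perm sgn n}) a c : adj x a c -> a != c.
Proof. by move/eqP=> ad; rewrite (eq_pos x) ad; lia. Qed.

Lemma refl_rev n (a c : sgn n) : refl (negT c) (negT a) = refl a c.
Proof. by rewrite refl_neg refl_sym. Qed.

(** Descents are undone as long as [(a, c)] stays inverted; one that cannot be undone is the pair
    itself or its mirror image. The result is join-irreducible. *)
Lemma min_above n (y : {perm sgn n}) a c : signed y -> inv y a c ->
  exists z, [/\ signed z, le z y, inv z a c &
    forall c0 a0, adj z c0 a0 -> key a0 < key c0 ->
      (a0 = a /\ c0 = c) \/ (a0 = negT c /\ c0 = negT a)].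
Proof.
have [m] := ubnP (ninv y); elim: m y => // m IH y ley sy ya.
case: (boolP [exists p, [&& adj y p.1 p.2, key p.2 < key p.1 & inv (y * refl p.1 p.2)%g a c]]).
  case/existsP=> [[c0 a0]] /= /and3P[ad lt0 za].
  have [z [sz adz E ltz lez]] := unswap sy ad lt0.
  have Ez : (y * refl c0 a0)%g = z by rewrite E (refl_sym c0) refl_sq.
  rewrite Ez in za; have [|t [st let_ ta H]] := IH z _ sz za.
    by rewrite ltnS in ley; apply: leq_trans ltz ley.
  by exists t; split=> //; apply: le_trans let_ lez.
move/existsPn=> H; exists y; split=> // c0 a0 ad lt0.
have [z [sz adz E _ _]] := unswap sy ad lt0.
have Ez : (y * refl c0 a0)%g = z by rewrite E (refl_sym c0) refl_sq.
have := H (c0, a0); rewrite /= ad lt0 Ez /=; move: ya; rewrite {1}E inv_swap //.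
case/or3P=> [->//|/andP[/eqP-> /eqP->] _|/andP[/eqP-> /eqP->] _]; first by left.
by right; rewrite !negTK.
Qed.

Section Forcing.
Variables (n : nat) (R : {perm sgn n} -> {perm sgn n} -> Prop).
Hypothesis congR : lat_cong R.
Implicit Types x y z w : {perm sgn n}.

(* The least [z] below the upper end having [(a, c)] as an inversion only depends on [a], [c] and
   the intermediate values standing before them. *)
Lemma arc_transfer x x' a c : signed x -> signed x' -> adj x a c -> adj x' a c -> key a < key c ->
  (forall e, key a < key e -> key e < key c -> (pos x e < pos x a) = (pos x' e < pos x' a)) ->
  R x (x * refl a c)%g -> R x' (x' * refl a c)%g.
Proof.
move=> sx sx' ad ad' ac same Rxy.
have sy := adj_signed_swap a c sx; have sy' := adj_signed_swap a c sx'.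
have xy := le_swapr sx ad ac; have xy' := le_swapr sx' ad' ac.
have ady := adj_swap sx ad; have ady' := adj_swap sx' ad'.
have [z [sz zy za H]] := min_above sy (inv_swapr sx ad ac).
(* An intermediate value before the descent [c a] of [z] is inverted with [a], also in the upper end
   of [x], so it stands before the pair in [x] and hence in [x']. Values after the descent are
   treated likewise. *)
have W p q : adj z c a -> key a <= key p -> key p < key q -> key q <= key c ->
    pos z q <= pos z c -> pos z a <= pos z p -> inv (x' * refl a c)%g p q.
  move=> /eqP adz h1 h2 h3 h4 h5.
  have Hq : pos (x' * refl a c)%g q <= pos (x' * refl a c)%g c.
    case: (eqVneq q c) => [->//|qc].
    have qa : q != a by rewrite eq_key; lia.
    have [_ E2 _ _] := swap_rel sx' ad' qa qc; have [E1 _ _ _] := swap_rel sx ad qa qc.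
    have : inv z a q by rewrite /inv; move: qc; rewrite (eq_pos z); lia.
    move/zy/inv_pos; rewrite E1 same -?E2; [exact: ltnW|lia|].
    by move: qc; rewrite eq_key; lia.
  have Hp : pos (x' * refl a c)%g a <= pos (x' * refl a c)%g p.
    case: (eqVneq p a) => [->//|pa].
    have pc : p != c by rewrite eq_key; lia.
    have [_ _ E3 _] := swap_rel sx' ad' pa pc; have [_ _ _ E4] := swap_rel sx ad pa pc.
    have : inv z p c by rewrite /inv; move: pa; rewrite (eq_pos z); lia.
    move/zy/inv_pos; rewrite E4 => xp; apply: ltnW; rewrite E3.
    rewrite ltn_neqAle -eq_pos eq_sym pa leqNgt -same -?leqNgt ?(ltnW xp) //; last lia.
    by move: pa; rewrite eq_key; lia.
  by rewrite /inv h2 /=; move/eqP: ady'; lia.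
have zy' : le z (x' * refl a c)%g.
  apply: le_of_descents => c0 a0 p q ad0 h1 h2 h3 h4 h5.
  have [|[E1 E2]|[E1 E2]] := H _ _ ad0; first lia.
    by apply: W; rewrite -?E1 -?E2.
  rewrite E1 E2 in ad0 h1 h3 h4 h5.
  have K := @inv_neg _ (x' * refl a c)%g p q sy'; rewrite -K.
  have kp := key_neg p; have kq := key_neg q; have ka := key_neg a; have kc := key_neg c.
  have pp := pos_neg p sz; have pq := pos_neg q sz.
  have pa := pos_neg a sz; have pc := pos_neg c sz.
  by apply: W; [rewrite -adj_neg | clear - h1 h2 h3 h4 h5 kp kq ka kc pp pq pa pc; lia..].
(* Meeting the given cover with [z] makes [z] congruent to an element below [x']; joining with [x']
   yields the cover there. *)
have [m Hm] := meet_ex sx sz; have [sm mx mz _] := (is_meetP m sx sz).1 Hm.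
have Rmz : R m z.
  by apply: (cong_meet congR sz Rxy Hm); apply/is_meetP => //; split.
have mx' : le m x'.
  apply: (le_unswap sx' sm ad' ac (le_trans mz zy')).
  by apply/negP=> /mx h; move: (adj_ninv ad); rewrite h.
apply: (cong_join congR sx' Rmz); apply/is_joinP => //; split=> // k sk zk x'k.
by apply: le_swap => //; apply: zk.
Qed.

Section Step.
Variables (U : pred (sgn n)).
Hypothesis UN : forall a, U (negT a) = ~~ U a.

Definition contracted a c := forall x, signed x -> adj x a c -> key a < key c ->
  contr U x a c -> R x (x * refl a c)%g.

(* [w] is the bottom of a polygon with atoms [z] and [z'], and [x] lies on the chain through [z]. *)
Lemma side_edge w z z' x a c : signed w -> signed z -> signed z' -> signed x ->
  adj x a c -> key a < key c -> le w z -> le w z' -> le z x -> ~~ inv z' a c ->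
  (forall k, signed k -> le z k -> le z' k -> le (x * refl a c)%g k) ->
  R w z \/ R w z' -> R x (x * refl a c)%g.
Proof.
move=> sw sz sz' sx ad ac wz wz' zx nz' H; have sy := adj_signed_swap a c sx.
have xy := le_swapr sx ad ac.
(* If [w] and [z'] are congruent, the cover is reached by joining with [x]. If [w] and [z] are, then
   [z'] is congruent to the join of [z] and [z'], and the cover is reached from above. *)
case=> Rw; last first.
  apply: (cong_up congR Rw) => //; first exact: le_trans wz zx.
  by move=> k sk xk z'k; apply: H => //; apply: le_trans zx xk.
have [j Hj] := join_ex sz sz'; have [sj zj z'j _] := (is_joinP j sz sz').1 Hj.
have Rz' : R z' j.
  by apply: (cong_join congR sz' Rw _ Hj); apply/is_joinP => //; split.
apply: (cong_down congR Rz') => //; first exact: H.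
move=> k sk ky kz'; apply: (@le_unswap _ x k a c) => //.
  by apply/negP=> /kz' h; rewrite h in nz'.
Qed.

Definition witness x a b := if U b then pos x b < pos x a else pos x a < pos x b.

Lemma contr_witness x a c b : key a < key b -> key b < key c -> witness x a b -> contr U x a c.
Proof. by move=> ab bc h; apply/existsP; exists b; rewrite ab bc. Qed.

Lemma witness_adj x a c b : adj x a c -> b != a -> b != c -> witness x a b = witness x c b.
Proof. by move=> ad ba bc; rewrite /witness (adj_bef ad) // (adj_aft ad). Qed.

Lemma witness_swap x a c b : signed x -> adj x a c -> b != a -> b != c ->
  witness (x * refl a c)%g a b = witness x a b.
Proof. by move=> sx ad ba bc; rewrite /witness; have [-> _ -> _] := swap_rel sx ad ba bc. Qed.

Lemma witness_swap_r x a c b : signed x -> adj x a c -> b != a -> b != c ->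
  witness (x * refl a c)%g c b = witness x a b.
Proof. by move=> sx ad ba bc; rewrite /witness; have [_ -> _ ->] := swap_rel sx ad ba bc. Qed.

Lemma witness_neg x a b : signed x -> witness x (negT a) (negT b) = witness x a b.
Proof. by move=> sx; rewrite /witness UN !ltn_pos_neg //; case: (U b). Qed.

(* Consecutive entries [f a c]; the bottom of the hexagon reads [a f c]. *)
Lemma hexagon x f a c b : signed x -> adj x f a -> adj x a c -> c != negT a ->
  key a < key f -> key f < key c -> b != f -> key a < key b -> key b < key c ->
  witness x a b -> contracted a f -> contracted f c -> R x (x * refl a c)%g.
Proof.
move=> sx adf ad ca af fc bf ab bc wb IH1 IH2; have ac := ltn_trans af fc.
have [sw adw Ex] := descE sx adf af.
move: (x * refl f a)%g sw adw Ex => w sw adw Ex.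
have ba : b != a by rewrite eq_key; lia.
have bc' : b != c by rewrite eq_key; lia.
have adwc : adj w f c.
  have -> : w = (x * refl f a)%g by rewrite Ex (refl_sym f) refl_sq.
  have fa' : f != a by rewrite eq_key; lia.
  rewrite /adj !pos_swap // !eqxx -!(eq_pos x).
  have /negbTE-> : c != f by rewrite eq_key; lia.
  have /negbTE-> : c != a by rewrite eq_key; lia.
  have /negbTE-> : c != negT f.
    apply/eqP=> E; have := pos_neg f sx; have := pos_neg a sx.
    by move: ad adf; rewrite /adj E; lia.
  by rewrite (negbTE ca); exact: ad.
have sz' := adj_signed_swap f c sw.
have wx : le w x by rewrite Ex; apply: le_swapr.
apply: (@side_edge w x (w * refl f c)%g) => //; first exact: le_swapr.
- rewrite inv_swap // negb_or; apply/andP; split.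
    by apply/negP=> /wx h; move: (adj_ninv ad); rewrite h.
  rewrite !eq_key; have := key_neg f; move: ca; rewrite eq_key; have := key_neg a; have := key_neg c; lia.
- move=> k sk xk z'k; apply: le_swap => //; apply: (@inv_trans _ _ a f c).
    by apply: xk; rewrite Ex; apply: inv_swapr.
  by apply: z'k; apply: inv_swapr.
have wwb : witness w a b by move: wb; rewrite Ex witness_swap.
(* Below [f], the witness contracts the bottom edge swapping [a] and [f]; above [f], the one
   swapping [f] and [c]. *)
case: (ltngtP (key b) (key f)) => [h|h|/key_inj E]; last by rewrite E eqxx in bf.
  by left; rewrite Ex; apply: IH1 => //; apply: contr_witness wwb.
right; apply: IH2 => //; apply: (@contr_witness _ _ _ b) => //.
by rewrite -(witness_adj adw).
Qed.

Lemma contracted_neg a c : contracted a c -> contracted (negT c) (negT a).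
Proof.
move=> H x sx ad ac ct; rewrite refl_rev.
have ad' : adj x a c by rewrite -adj_neg.
have ac' : key a < key c by rewrite -ltn_key_neg.
by apply: H => //; have := contr_neg UN sx ad ct; rewrite !negTK.
Qed.

(** Read in the mirror, the consecutive entries are [-g -c -a], and [hexagon] applies. *)
Lemma hexagon' x a c g b : signed x -> adj x a c -> adj x c g -> c != negT a ->
  key a < key g -> key g < key c -> b != g -> key a < key b -> key b < key c ->
  witness x a b -> contracted a g -> contracted g c -> R x (x * refl a c)%g.
Proof.
move=> sx ad adg ca ag gc bg ab bc wb IH1 IH2; rewrite -refl_rev.
have ba : b != a by rewrite eq_key; lia.
have bc' : b != c by rewrite eq_key; lia.
apply: (@hexagon x (negT g) (negT c) (negT a) (negT b)); rewrite ?adj_neg ?ltn_key_neg ?witness_neg //.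
- by rewrite negTK eq_sym.
- by rewrite (inj_eq (inv_inj (@negTK n))).
- by rewrite -(witness_adj ad).
- exact: contracted_neg.
exact: contracted_neg.
Qed.
End Step.
End Forcing.

Lemma pos_swap_l n (x : {perm sgn n}) a c : signed x -> a != c -> pos (x * refl a c)%g a = pos x c.
Proof. by move=> sx ac; rewrite pos_swap // eqxx. Qed.

Lemma pos_swap_r n (x : {perm sgn n}) a c : signed x -> a != c -> pos (x * refl a c)%g c = pos x a.
Proof. by move=> sx ac; rewrite refl_sym pos_swap_l // eq_sym. Qed.

Lemma pos_swap_other n (x : {perm sgn n}) a c v : signed x -> a != c ->
  v != a -> v != c -> v != negT a -> v != negT c -> pos (x * refl a c)%g v = pos x v.
Proof.
move=> sx ac h1 h2 h3 h4; rewrite pos_swap // -!(eq_pos x).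
by rewrite (negbTE h1) (negbTE h2) (negbTE h3) (negbTE h4).
Qed.

Lemma center_adj n (x : {perm sgn n}) u : signed x -> adj x (negT u) u = (pos x u == n).
Proof. move=> sx; rewrite /adj; have := pos_neg u sx; lia. Qed.

(** * Octagons around the middle of the full notation *)

Section Octagon.
Variables (n : nat) (R : {perm sgn n} -> {perm sgn n} -> Prop).
Hypothesis congR : lat_cong R.
Variables (U : pred (sgn n)).
Hypothesis UN : forall a, U (negT a) = ~~ U a.
Implicit Types x y z w : {perm sgn n}.
Local Notation contracted := (contracted R U).

(* [x] reads [-g -c c g] around the middle, with [g] positive; the bottom reads [-c -g g c]. *)
Lemma octagon_pos x c g b : signed x -> adj x (negT c) c -> adj x c g ->
  key (negT g) < key g -> key g < key c -> b != g -> key (negT g) < key b -> key b < key c ->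
  witness U x (negT c) b -> contracted (negT g) g -> contracted g c ->
  R x (x * refl (negT c) c)%g.
Proof.
move=> sx ad adg g0 gc bg gb bc wb IH1 IH2.
have kg := key_neg g; have kc := key_neg c; have kb := key_neg b.
have [sw adw Ex] := descE sx adg gc.
have wg : pos (x * refl c g)%g g = n.
  by rewrite pos_swap_r ?(adj_key_neq adg) //; apply/eqP; rewrite -center_adj.
move: (x * refl c g)%g sw adw Ex wg => w sw adw Ex wg.
have adg' : adj w (negT g) g by rewrite center_adj // wg.
have bc' : b != c by rewrite eq_key; mlia.
have bnc : b != negT c by rewrite eq_key; mlia.
have bng : b != negT g by rewrite eq_key; mlia.
have wx : le w x by rewrite Ex; apply: le_swapr.
have ltc : key (negT c) < key c by mlia.
have sz' := adj_signed_swap (negT g) g sw.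
apply: (@side_edge _ _ congR w x (w * refl (negT g) g)%g) => //; first exact: le_swapr.
- rewrite inv_swap // !eq_key !negb_or; apply/and3P; split; try by mlia.
  by apply/negP=> /wx h; move: (adj_ninv ad); rewrite h.
- move=> k sk xk z'k; apply: le_swap => //.
  have k1 : inv k g c by apply: xk; rewrite Ex; apply: inv_swapr.
  have k2 : inv k (negT g) g by apply: z'k; apply: inv_swapr.
  by apply: inv_trans (inv_trans k2 k1); rewrite inv_neg.
have wwb : witness U w g b.
  by rewrite -(@witness_swap_r _ U w g c) // -Ex -(witness_adj U ad).
case: (ltngtP (key b) (key g)) => [h|h|/key_inj E]; last by rewrite E eqxx in bg.
  right; apply: IH1 => //; apply: (@contr_witness _ _ _ _ _ b) => //.
  by rewrite (witness_adj U adg').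
by left; rewrite Ex; apply: IH2 => //; apply: contr_witness wwb.
Qed.

(* The same with [g] negative; the bottom reads [-c g -g c]. *)
Lemma octagon_neg x c g b : signed x -> adj x (negT c) c -> adj x c g ->
  key g < key (negT g) -> key (negT c) < key g -> b != negT g -> key g < key b -> key b < key c ->
  witness U x (negT c) b -> contracted g (negT g) -> contracted (negT g) c ->
  R x (x * refl (negT c) c)%g.
Proof.
move=> sx ad adg g0 cg bg gb bc wb IH1 IH2.
have kg := key_neg g; have kc := key_neg c; have kb := key_neg b.
have gc : key g < key c by mlia.
have [sx1 adx1 Ex] := descE sx adg gc.
have xg : pos (x * refl c g)%g g = n.
  by rewrite pos_swap_r ?(adj_key_neq adg) //; apply/eqP; rewrite -center_adj.
move: (x * refl c g)%g sx1 adx1 Ex xg => x1 sx1 adx1 Ex xg.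
have adg' : adj x1 (negT g) g by rewrite center_adj // xg.
have [sw adw Ex1] := descE sx1 adg' g0.
have gng : negT g != g by rewrite eq_key; mlia.
have adwc : adj (x1 * refl (negT g) g)%g (negT g) c.
  have [c1 c2] : c != negT g /\ c != g by rewrite !eq_key; clear - g0 cg kg kc gc; lia.
  by rewrite /adj pos_swap_l // pos_swap_other ?negTK.
move: (x1 * refl (negT g) g)%g sw adw Ex1 adwc => w sw adw Ex1 adwc.
have bc' : b != c by rewrite eq_key; mlia.
have bnc : b != negT c by rewrite eq_key; mlia.
have bg' : b != g by rewrite eq_key; mlia.
have wx1 : le w x1 by rewrite Ex1; apply: le_swapr.
have x1x : le x1 x by rewrite Ex; apply: le_swapr.
have ltc : key (negT c) < key c by mlia.
have ltgc : key (negT g) < key c by mlia.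
have sz' := adj_signed_swap (negT g) c sw.
apply: (@side_edge _ _ congR w x1 (w * refl (negT g) c)%g) => //; first exact: le_swapr.
- rewrite inv_swap // !eq_key !negb_or negTK; apply/and3P; split; try by mlia.
  by apply/negP=> /wx1 /x1x h; move: (adj_ninv ad); rewrite h.
- move=> k sk xk z'k.
  have k1 : inv k g (negT g) by apply: xk; rewrite Ex1; apply: inv_swapr.
  have k2 : inv k (negT g) c by apply: z'k; apply: inv_swapr.
  apply: le_swap => //.
    by rewrite Ex; apply: le_swap => //; apply: inv_trans k1 k2.
  by apply: inv_trans (inv_trans k1 k2); rewrite -[g in inv _ _ g]negTK inv_neg.
have wwb : witness U w g b.
  rewrite -(@witness_swap _ U w g (negT g)) // -Ex1.
  by rewrite -(@witness_swap_r _ U x1 g c) // -Ex -(witness_adj U ad).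
case: (ltngtP (key b) (key (negT g))) => [h|h|/key_inj E]; last by rewrite E eqxx in bg.
  by left; rewrite Ex1; apply: IH1 => //; apply: contr_witness wwb.
right; apply: IH2 => //; apply: (@contr_witness _ _ _ _ _ b) => //.
by rewrite -(witness_adj U adw).
Qed.

(* [x] reads [-p q -q p] around the middle; the bottom reads [-q -p p q]. *)
Lemma octagon_side x q p b : signed x -> adj x q (negT q) -> adj x (negT q) p ->
  key (negT p) < key p -> key p < key q -> key (negT q) < key b -> key b < key (negT p) ->
  witness U x (negT q) b -> contracted p q -> R x (x * refl (negT q) p)%g.
Proof.
move=> sx adq ad p0 pq qb bp wb IH.
have kq := key_neg q; have kp := key_neg p; have kb := key_neg b.
have qq : key (negT q) < key q by mlia.
have [sx1 adx1 Ex] := descE sx adq qq.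
have qnq : q != negT q by rewrite eq_key; mlia.
have adqp : adj (x * refl q (negT q))%g q p.
  have [c1 c2] : p != negT q /\ p != q by rewrite !eq_key; clear - p0 pq kp kq; lia.
  by rewrite /adj pos_swap_l // pos_swap_other ?negTK.
move: (x * refl q (negT q))%g sx1 adx1 Ex adqp => x1 sx1 adx1 Ex adqp.
have [sw adw Ex1] := descE sx1 adqp pq.
have wp : pos (x1 * refl q p)%g p = n.
  by rewrite pos_swap_r ?(adj_key_neq adqp) //; apply/eqP; rewrite -center_adj.
move: (x1 * refl q p)%g sw adw Ex1 wp => w sw adw Ex1 wp.
have adp : adj w (negT p) p by rewrite center_adj // wp.
have wx1 : le w x1 by rewrite Ex1; apply: le_swapr.
have x1x : le x1 x by rewrite Ex; apply: le_swapr.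
have ltqp : key (negT q) < key p by mlia.
have sz' := adj_signed_swap (negT p) p sw.
apply: (@side_edge _ _ congR w x1 (w * refl (negT p) p)%g) => //; first exact: le_swapr.
- rewrite inv_swap // !eq_key !negb_or negTK; apply/and3P; split; try by mlia.
  by apply/negP=> /wx1 /x1x h; move: (adj_ninv ad); rewrite h.
- move=> k sk xk z'k.
  have k1 : inv k p q by apply: xk; rewrite Ex1; apply: inv_swapr.
  have k2 : inv k (negT p) p by apply: z'k; apply: inv_swapr.
  have k3 : inv k (negT q) (negT p) by rewrite inv_neg.
  apply: le_swap => //; last exact: inv_trans k3 k2.
  by rewrite Ex; apply: le_swap => //; apply: inv_trans (inv_trans k3 k2) k1.
have bq : b != negT q by rewrite eq_key; mlia.
have bq' : b != q by rewrite eq_key; mlia.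
have bp' : b != negT p by rewrite eq_key; mlia.
have adw' : adj w (negT q) (negT p) by rewrite adj_neg.
have wwb : witness U w (negT q) b.
  rewrite -(@witness_swap _ U w (negT q) (negT p)) // refl_rev -Ex1.
  by rewrite -(@witness_swap _ U x1 (negT q) q) // -Ex.
(* The bottom edge swapping [p] and [q] also swaps [-q] and [-p], and [b] witnesses it in the latter
   form. *)
left; rewrite Ex1 -refl_rev; apply: contracted_neg => //; first by rewrite ltn_key_neg.
exact: contr_witness wwb.
Qed.
End Octagon.

(** * Moving an entry next to a pair *)

Lemma perm_of_key n (K : sgn n -> nat) N : injective K -> (forall v, K (negT v) + K v = N) ->
  exists2 x : {perm sgn n}, signed x & forall u v, (pos x u < pos x v) = (K u < K v).
Proof.
move=> Kinj KN; apply: (@perm_of_order _ (fun u v => K u < K v)).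
- by move=> u; rewrite ltnn.
- by move=> v u w; apply: ltn_trans.
- by move=> u v; rewrite -(inj_eq Kinj) neq_ltn.
by move=> u v; have := KN u; have := KN v; lia.
Qed.

Lemma adj_of_bef n (x : {perm sgn n}) a c : pos x a < pos x c ->
  (forall v, pos x a < pos x v -> ~~ (pos x v < pos x c)) -> adj x a c.
Proof.
move=> ac H; have [|v pv] := @pos_surj _ x (pos x a).+1.
  by apply: leq_ltn_trans (pos_lt x c).
by have := H v; rewrite pv /adj ltnSn -leqNgt => /(_ isT) h; rewrite eqn_leq h ac.
Qed.

(* New positions are spread out by a factor so that one entry can be inserted between two others. *)
Lemma move_after n (x : {perm sgn n}) a c e : signed x -> adj x a c -> n <= pos x c ->
  pos x c < pos x e -> exists x', [/\ signed x', adj x' a c, adj x' c e &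
    forall v, (pos x' v < pos x' a) = (pos x v < pos x a)].
Proof.
move=> sx /eqP ad pc ce.
(* An unmoved entry at position [p] gets [4p + 4], [e] goes right after [c], and [-e] gets the
   complement to [8n + 4], the sum of two mirror keys. *)
pose K v := if pos x v == pos x e then 4 * pos x c + 5 else
  if pos x v == pos x (negT e) then 8 * n - 4 * pos x c - 1 else 4 * pos x v + 4.
have ne := pos_neg e sx; have le_ := pos_lt x e.
have Ka : K a = 4 * pos x c by rewrite /K; do ?[case: eqP => ?]; lia.
have Kc : K c = 4 * pos x c + 4 by rewrite /K; do ?[case: eqP => ?]; lia.
have Ke : K e = 4 * pos x c + 5 by rewrite /K eqxx.
have [|v|x' sx' Hx'] := @perm_of_key _ K (8 * n + 4).
- by move=> u v E; apply: (@pos_inj _ x); move: E; rewrite /K; do ?[case: eqP => ?]; lia.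
- have nv := pos_neg v sx; have lv := pos_lt x v; rewrite /K; do ?[case: eqP => ?]; lia.
exists x'; split=> //.
- apply: adj_of_bef => [|v]; rewrite !Hx' Ka Kc; first lia.
  by rewrite /K; do ?[case: eqP => ?]; lia.
- apply: adj_of_bef => [|v]; rewrite !Hx' Ke Kc; first lia.
  by rewrite /K; do ?[case: eqP => ?]; lia.
by move=> v; rewrite Hx' Ka /K; do ?[case: eqP => ?]; lia.
Qed.

(** Placing [e] right before [a] puts [-e] in the left half, so [-e] changes sides if it stood after
    the pair; no other value does. *)
Lemma move_before n (x : {perm sgn n}) a c e : signed x -> adj x a c -> n <= pos x a ->
  e != negT a -> e != negT c -> pos x e < pos x a ->
  exists x', [/\ signed x', adj x' e a, adj x' a c &
    forall v, v != negT e \/ pos x v < pos x a -> (pos x' v < pos x' a) = (pos x v < pos x a)].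
Proof.
move=> sx /eqP ad pa; rewrite !(eq_pos x) => ea ec lea.
pose K v := if pos x v == pos x e then 4 * pos x a + 3 else
  if pos x v == pos x (negT e) then 8 * n + 1 - 4 * pos x a else 4 * pos x v + 4.
have ne := pos_neg e sx; have na := pos_neg a sx; have nc := pos_neg c sx.
have la := pos_lt x a; have lc := pos_lt x c.
have Ka : K a = 4 * pos x a + 4 by rewrite /K; do ?[case: eqP => ?]; lia.
have Kc : K c = 4 * pos x a + 8 by rewrite /K; do ?[case: eqP => ?]; lia.
have Ke : K e = 4 * pos x a + 3 by rewrite /K eqxx.
have [|v|x' sx' Hx'] := @perm_of_key _ K (8 * n + 4).
- by move=> u v E; apply: (@pos_inj _ x); move: E; rewrite /K; do ?[case: eqP => ?]; lia.
- have nv := pos_neg v sx; have lv := pos_lt x v; rewrite /K; do ?[case: eqP => ?]; lia.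
exists x'; split=> //.
- apply: adj_of_bef => [|v]; rewrite !Hx' Ka Ke; first lia.
  by rewrite /K; do ?[case: eqP => ?]; lia.
- apply: adj_of_bef => [|v]; rewrite !Hx' Ka Kc; first lia.
  by rewrite /K; do ?[case: eqP => ?]; lia.
move=> v; rewrite Hx' Ka (eq_pos x) => Hv; move: Hv; rewrite /K.
by do ?[case: eqP => ?] => // -[|]; lia.
Qed.

(** Mirror keys add up to [16n + 8]. The positions of [-c -a a c] get keys next to the centre
    [8n + 4], that of [b] gets an extreme key [B], and the others keep their order with keys that
    are multiples of 8, leaving a gap around the centre. *)
Lemma center_key n pa pc pna pnc pb pnb B : pc = pa.+1 -> n <= pa -> pc < n.*2 ->
  pna + pa + 1 = n.*2 -> pnc + pc + 1 = n.*2 -> pnb + pb + 1 = n.*2 ->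
  pb != pa -> pb != pc -> pb != pna -> pb != pnc -> B = 0 \/ B = 16 * n + 8 ->
  exists F, [/\ forall k l, k < n.*2 -> l < n.*2 -> F k = F l -> k = l,
    forall k l, k + l + 1 = n.*2 -> F k + F l = 16 * n + 8,
    forall k, k < n.*2 -> k != pa -> k != pc -> k != pna -> F k <= 8 * n + 2 \/ 8 * n + 8 <= F k &
    [/\ F pa = 8 * n + 5, F pc = 8 * n + 6, F pna = 8 * n + 3 & F pb = B]].
Proof.
move=> Ec la lc na nc nb h1 h2 h3 h4 HB.
pose F k := if k == pa then 8 * n + 5 else if k == pc then 8 * n + 6 else
  if k == pna then 8 * n + 3 else if k == pnc then 8 * n + 2 else
  if k == pb then B else if k == pnb then 16 * n + 8 - B else 8 * k + 8.
(* [G] is a left inverse of [F] on positions, whence injectivity. *)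
pose G y := if y == 8 * n + 5 then pa else if y == 8 * n + 6 then pc else
  if y == 8 * n + 3 then pna else if y == 8 * n + 2 then pnc else
  if y == B then pb else if y == 16 * n + 8 - B then pnb else (y - 8) %/ 8.
have FE k : [\/ k = pa, k = pc | k = pna] \/ [\/ k = pnc, k = pb | k = pnb] \/
    ([&& k != pa, k != pc, k != pna, k != pnc, k != pb & k != pnb] /\ F k = 8 * k + 8).
  rewrite /F; case: (k =P pa) => [|_]; first by left; apply: Or31.
  case: (k =P pc) => [|_]; first by left; apply: Or32.
  case: (k =P pna) => [|_]; first by left; apply: Or33.
  case: (k =P pnc) => [|_]; first by right; left; apply: Or31.
  case: (k =P pb) => [|_]; first by right; left; apply: Or32.
  case: (k =P pnb) => [|_]; first by right; left; apply: Or33.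
  by right; right.
have Fa : F pa = 8 * n + 5 by rewrite /F eqxx.
have Fc : F pc = 8 * n + 6 by rewrite /F eqxx; case: eqP => //; clear -Ec; lia.
have Fna : F pna = 8 * n + 3 by rewrite /F eqxx; do 2?[case: eqP => [E|_]] => //; clear -E Ec la na; lia.
have Fnc : F pnc = 8 * n + 2.
  by rewrite /F eqxx; do 3?[case: eqP => [E|_]] => //; clear -E Ec la na nc; lia.
have Fb : F pb = B by rewrite /F eqxx (negbTE h1) (negbTE h2) (negbTE h3) (negbTE h4).
have Fnb : F pnb = 16 * n + 8 - B.
  by rewrite /F eqxx; do 5?[case: eqP => [E|_]] => //; clear -E h1 h2 h3 h4 na nc nb; lia.
exists F; split=> //.
- suff GF k : k < n.*2 -> G (F k) = k by move=> k l lk ll E; rewrite -(GF k) // E GF.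
  move=> lk; case: (FE k) => [[] ->|[[] ->|[_ ->]]]; rewrite ?Fa ?Fc ?Fna ?Fnc ?Fb ?Fnb /G; clear -HB lk;
    case: HB => ->; do ?[case: eqP => [?|//]] => //; lia.
- move=> k l kl; case: (FE k) => [[] E|[[] E|[Hk ->]]].
  + by have -> : l = pna by [lia]; rewrite E Fa Fna; clear; lia.
  + by have -> : l = pnc by [lia]; rewrite E Fc Fnc; clear; lia.
  + by have -> : l = pa by [lia]; rewrite E Fa Fna; clear; lia.
  + by have -> : l = pc by [lia]; rewrite E Fc Fnc; clear; lia.
  + by have -> : l = pnb by [lia]; rewrite E Fb Fnb; clear -HB; lia.
  + by have -> : l = pb by [lia]; rewrite E Fb Fnb; clear -HB; lia.
  case: (FE l) => [[] E|[[] E|[_ ->]]]; last (clear -kl; lia); clear -E Hk kl Ec na nc nb; lia.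
move=> k lk k1 k2 k3; case: (FE k) => [[] E|[[] E|[_ ->]]].
- by rewrite E eqxx in k1.
- by rewrite E eqxx in k2.
- by rewrite E eqxx in k3.
- by rewrite E Fnc; left.
- by rewrite E Fb; clear -HB; lia.
- by rewrite E Fnb; clear -HB; lia.
by clear -lk; lia.
Qed.

(** Among the other values only [b] is promised to keep its side; this is applied when the remaining
    intermediate values are among [-a] and [-c]. *)
Lemma move_center n (x : {perm sgn n}) a c b : signed x -> adj x a c -> n <= pos x a ->
  [&& b != a, b != c, b != negT a & b != negT c] ->
  exists x', [/\ signed x', adj x' (negT a) a, adj x' a c &
    (pos x' b < pos x' a) = (pos x b < pos x a)].
Proof.
move=> sx /eqP ad pa; rewrite !(eq_pos x) => /and4P[ba bc bna bnc].
have [B BE BE'] : exists2 B, B = 0 \/ B = 16 * n + 8 & (B == 0) = (pos x b < pos x a).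
  by case: ltnP => h; [exists 0; [left|] | exists (16 * n + 8); [right|lia]].
have [F [inF sumF lowF [Fa Fc Fna Fb]]] := center_key ad pa (pos_lt x c) (pos_neg a sx)
  (pos_neg c sx) (pos_neg b sx) ba bc bna bnc BE.
have [||x' sx' Hx'] := @perm_of_key _ (fun v => F (pos x v)) (16 * n + 8).
- by move=> u v /inF E; apply: (@pos_inj _ x); apply: E; apply: pos_lt.
- by move=> v; apply: sumF; apply: pos_neg.
have gap v : v != a -> v != c -> v != negT a ->
    F (pos x v) <= 8 * n + 2 \/ 8 * n + 8 <= F (pos x v).
  by rewrite !(eq_pos x); apply: lowF; apply: pos_lt.
exists x'; split; first exact: sx'.
- apply: adj_of_bef => [|v]; rewrite !Hx' Fa Fna ?ltn_add2l //.
  case: (eqVneq v a) => [->|h1]; first by rewrite Fa ltnn.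
  case: (eqVneq v c) => [->|h2]; first by rewrite Fc !ltn_add2l.
  case: (eqVneq v (negT a)) => [->|h3]; first by rewrite Fna ltnn.
  by case: (gap v h1 h2 h3) => h; clear -h; lia.
- apply: adj_of_bef => [|v]; rewrite !Hx' Fa Fc ?ltn_add2l //.
  case: (eqVneq v a) => [->|h1]; first by rewrite Fa ltnn.
  case: (eqVneq v c) => [->|h2]; first by rewrite Fc ltnn.
  case: (eqVneq v (negT a)) => [->|h3]; first by rewrite Fna !ltn_add2l.
  by case: (gap v h1 h2 h3) => h; clear -h; lia.
by rewrite Hx' Fa Fb -BE'; case: BE => ->; clear; lia.
Qed.

(** * Every contracted cover is forced *)

Section Generated.
Variables (n : nat) (up : nat -> bool) (R : {perm sgn n} -> {perm sgn n} -> Prop).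
Hypothesis congR : lat_cong R.
Hypothesis genR : forall s t : 'I_n, arrow up s t -> R (gen t) (gword s t).
Implicit Types x y z w : {perm sgn n}.
Local Notation U := (@upS n up).
Local Notation contracted := (contracted R U).
Let UN : forall a : sgn n, U (negT a) = ~~ U a := @upSN n up.

Lemma positive (b : sgn n) : n <= key b -> exists i, b = (false, i).
Proof. by case: b => [[] i]; [rewrite /key /=; have := ltn_ord i; lia | exists i]. Qed.

Lemma gen_le x (i : 'I_n) : signed x -> inv x (ps i) (false, i) -> le (gen i) x.
Proof.
move=> sx h p q; rewrite inv_gen => /orP[|] /andP[/eqP-> /eqP->] //.
by rewrite -[(true, i)]/(negT (false, i)) inv_neg.
Qed.

(** The generator lies below [x], and everything above [x] and the alternating word inverts
    [(a, c)], so [cong_up] applies. The two cases are three consecutive values, and the pair [-2, 2]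
    with witness 1. *)
Lemma gen_edge x a c b : signed x -> adj x a c -> key a < key c -> n <= key b -> key c = (key b).+1 ->
  (U b -> forall i : 'I_n, b = (false, i) -> inv x (ps i) b) -> (~~ U b -> inv x b c) ->
  key b = (key a).+1 \/ key b = n /\ a = negT c -> R x (x * refl a c)%g.
Proof.
move=> sx ad ac nb cb H1 H2 Hac; have xy := le_swapr sx ad ac; have sy := adj_signed_swap a c sx.
have [i Eb] := positive nb; have [j Ec] : exists j, c = (false, j) by apply: positive; lia.
have ij : val j = (val i).+1 by move: cb; rewrite Eb Ec /key /=; lia.
have Hv v : inv v (ps i) (false, j) -> (val i = 0 -> inv v (negT (false, j)) (false, j)) -> inv v a c.
  move=> v1 v2; case: Hac => [kb|[kb ->]]; last first.
    by rewrite Ec; apply: v2; move: kb; rewrite Eb /key /=; lia.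
  have -> : a = ps i by apply: key_inj; move: kb; rewrite Eb key_ps; lia.
  by rewrite Ec.
case: (boolP (U b)) => Ub.
  have := H1 Ub i Eb; rewrite Eb in Ub *; have [ar _ v1 v2] := arrow_up ij Ub => h.
  apply: (cong_up congR (genR ar)) => //; first exact: gen_le.
  by move=> k sk xk vk; apply: le_swap => //; apply: Hv => // *; apply: vk; auto.
have := H2 Ub; rewrite Eb in Ub *; have [ar _ v1 v2] := arrow_down ij Ub => h.
apply: (cong_up congR (genR ar)) => //.
  by apply: gen_le => //; rewrite (ps_succ ij) -Ec.
by move=> k sk xk vk; apply: le_swap => //; apply: Hv => // *; apply: vk; auto.
Qed.

Lemma base_simple x a c b : signed x -> adj x a c -> n <= key b -> key b = (key a).+1 ->
  key c = (key b).+1 -> witness U x a b -> R x (x * refl a c)%g.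
Proof.
move=> sx ad nb ab bc wb; have ba : b != a by rewrite eq_key; mlia.
have bc' : b != c by rewrite eq_key; mlia.
apply: (@gen_edge x a c b) => //; first by mlia.
- move=> Ub i Eb; have -> : ps i = a by apply: key_inj; move: ab; rewrite Eb key_ps; mlia.
  by move: wb; rewrite /witness Ub /inv ab ltnSn.
- move=> Ub; move: wb; rewrite (witness_adj U ad) // /witness (negbTE Ub) /inv bc ltnSn //.
by left.
Qed.

Lemma base_center x c b : signed x -> adj x (negT c) c -> key b = n ->
  key c = (key b).+1 -> witness U x (negT c) b -> R x (x * refl (negT c) c)%g.
Proof.
move=> sx ad nb bc wb; have kc := key_neg c; have kb := key_neg b.
have bc' : b != c by rewrite eq_key; mlia.
have bc'' : b != negT c by rewrite eq_key; mlia.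
apply: (@gen_edge x _ c b) => //; try by mlia.
- move=> Ub i Eb; have -> : ps i = negT b by apply: key_inj; move: kb nb; rewrite Eb key_ps; mlia.
  move: wb; rewrite /witness Ub /inv; have := pos_neg b sx; have := pos_neg c sx.
  by move/eqP: ad; mlia.
- by move=> Ub; move: wb; rewrite (witness_adj U ad) // /witness (negbTE Ub) /inv bc ltnSn.
by right.
Qed.

Lemma witness_same x x' a b : (pos x' b < pos x' a) = (pos x b < pos x a) -> b != a ->
  witness U x' a b = witness U x a b.
Proof.
move=> E ba; rewrite /witness E; case: (U b) => //.
by have := ba; have := ba; rewrite {1}(eq_pos x) (eq_pos x'); mlia.
Qed.

(** A hexagon is formed by moving [e] next to the pair, on the side where it stands. A move from the
    left may carry [-e] across the pair; the disjunction rules this out for an intermediate [-e]. *)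
Lemma reduce x a c e b : signed x -> adj x a c -> key a < key e -> key e < key c -> n <= pos x a ->
  e != negT a -> e != negT c -> e != b -> key a < key b -> key b < key c -> witness U x a b ->
  (pos x a < pos x e \/ (key a < key (negT e) -> key (negT e) < key c -> pos x (negT e) < pos x a)) ->
  contracted a e -> contracted e c -> R x (x * refl a c)%g.
Proof.
move=> sx ad ae ec pa ena enc eb ab bc wb He IH1 IH2; have ac : key a < key c by mlia.
have ba : b != a by rewrite eq_key; mlia.
have ea : e != a by rewrite eq_key; mlia.
have eC : e != c by rewrite eq_key; mlia.
have be : b != e by rewrite eq_sym.
have ca : c != negT a.
  by rewrite (eq_pos x); have := pos_neg a sx; move/eqP: (ad); mlia.
case: (ltnP (pos x a) (pos x e)) => hpe.
  have [||x' [sx' ad' ad'' same]] := @move_after _ x a c e sx ad.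
  - by move/eqP: (ad); mlia.
  - by move: eC; rewrite (eq_pos x); move/eqP: (ad); mlia.
  apply: (arc_transfer congR sx' sx ad' ad) => //.
  by apply: (@hexagon' _ _ congR U UN x' a c e b) => //; rewrite (witness_same (same b)).
have {}hpe : pos x e < pos x a by rewrite ltn_neqAle hpe -eq_pos ea.
case: He => [|He]; first by mlia.
have [x' [sx' ad' ad'' same]] := move_before sx ad pa ena enc hpe.
have same' v : key a < key v -> key v < key c -> (pos x' v < pos x' a) = (pos x v < pos x a).
  move=> h1 h2; apply: same; case: (eqVneq v (negT e)) => [E|]; [right|by left].
  by rewrite E in h1 h2 *; apply: He.
apply: (arc_transfer congR sx' sx ad'' ad) => //.
by apply: (@hexagon _ _ congR U x' e a c b) => //; rewrite (witness_same (same' b _ _)).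
Qed.

(** Once [e] is moved, the middle reads [-e -c c e]; the sign of [e] selects the octagon. *)
Lemma reduce_center x c e b : signed x -> adj x (negT c) c -> key (negT c) < key e -> key e < key c ->
  pos x c < pos x e -> b != e -> b != negT e -> n <= key b -> key b < key c ->
  witness U x (negT c) b ->
  (forall a' c', key (negT c) <= key a' -> key c' <= key c -> key c' - key a' < key c - key (negT c) ->
     contracted a' c') -> R x (x * refl (negT c) c)%g.
Proof.
move=> sx ad e1 e2 pe be bne nb bc wb IH.
have ke := key_neg e; have kc := key_neg c; have kb := key_neg b.
have pc : pos x c = n by apply/eqP; rewrite -center_adj.
have bnc : b != negT c by rewrite eq_key; mlia.
have [||x' [sx' ad' ad'' same]] := @move_after _ x (negT c) c e sx ad => //; first by rewrite pc.
have ltc : key (negT c) < key c by mlia.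
apply: (arc_transfer congR sx' sx ad' ad) => //.
have wb' : witness U x' (negT c) b by rewrite (witness_same (same b)).
case: (ltngtP (key e) (key (negT e))) => h; last by mlia.
  by apply: (@octagon_neg _ _ congR U x' c e b) => //; try mlia; apply: IH; mlia.
by apply: (@octagon_pos _ _ congR U x' c e b) => //; try mlia; apply: IH; mlia.
Qed.

Lemma contracted_half x a c b : signed x -> adj x a c -> n <= pos x c ->
  key a < key b -> key b < key c -> witness U x a b ->
  (forall a' c', key a <= key a' -> key c' <= key c -> key c' - key a' < key c - key a ->
     contracted a' c') -> R x (x * refl a c)%g.
Proof.
move=> sx ad pc ab bc wb IH; have ac : key a < key c by mlia.
have ka := key_neg a; have kb := key_neg b; have kc := key_neg c.
have pna := pos_neg a sx; have pnc := pos_neg c sx; have pnb := pos_neg b sx.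
have ba : b != a by rewrite eq_key; mlia.
case: (eqVneq a (negT c)) => [Ea|ca].
  rewrite Ea in ad ab wb IH ac pna ba *.
  (* For a central pair [-b] is a witness along with [b], so [b] may be taken positive. *)
  wlog nb : b ab bc wb kb pnb ba / n <= key b.
    move=> W; case: (leqP n (key b)) => [nb|nb]; first exact: (W b).
    have bc' : b != c by rewrite eq_key; mlia.
    apply: (W (negT b)); rewrite ?negTK //; try by mlia.
    - by rewrite (witness_neg UN) // -(witness_adj U ad).
    - by rewrite eq_key; mlia.
  case: (boolP [exists e, [&& key (negT c) < key e, key e < key c, e != b & e != negT b]]).
    case/existsP=> e /and4P[e1 e2 eb enb]; have ke := key_neg e.
    have pc' : pos x c = n by apply/eqP; rewrite -center_adj.
    wlog pe : e e1 e2 eb enb ke / pos x c < pos x e.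
      move=> W; case: (ltnP (pos x c) (pos x e)) => [|h]; first exact: (W e).
      have ec : e != c by rewrite eq_key; mlia.
      apply: (W (negT e)); rewrite ?negTK //; try by mlia.
      - by apply: contra enb => /eqP <-; rewrite negTK.
      - by rewrite (inj_eq (inv_inj (@negTK n))).
      have enc : e != negT c by rewrite eq_key; mlia.
      by move: ec enc; rewrite !(eq_pos x); have := pos_neg e sx; mlia.
    apply: (@reduce_center x c e b) => //; first by rewrite eq_sym.
    by apply: contra enb => /eqP ->; rewrite negTK.
  (* Only [b] and [-b] lie between [-c] and [c], so [b] is 1 and [c] is 2. *)
  move/existsPn=> none.
  have out k : key (negT c) < k -> k < key c -> k = key b \/ k = key (negT b).
    move=> k1 k2; have [|e Ee] := @key_surj n k; first by have := key_lt c; mlia.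
    have := none e; rewrite !eq_key Ee k1 k2 /=; mlia.
  have Kb : key b = n.
    by case: (out n); mlia.
  apply: (base_center sx ad Kb _ wb).
  case: (ltngtP (key c) (key b).+1) => //; first by mlia.
  by move=> h; case: (out (key b).+1); mlia.
have pa : n <= pos x a.
  by move: ca; rewrite (eq_pos x); move/eqP: ad; mlia.
case: (boolP [exists e, [&& key a < key e, key e < key c, e != b, e != negT a & e != negT c]]).
  case/existsP=> e /and5P[e1 e2 eb ena enc]; have ke := key_neg e.
  have ea : e != a by rewrite eq_key; mlia.
  have red (u w : sgn n) : key a < key u -> key u < key c -> u != negT a -> u != negT c -> u != w ->
      key a < key w -> key w < key c -> witness U x a w ->
      (pos x a < pos x u \/ (key a < key (negT u) -> key (negT u) < key c -> pos x (negT u) < pos x a)) ->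
      R x (x * refl a c)%g.
    by move=> u1 u2 *; apply: (@reduce x a c u w) => //; apply: IH; clear -u1 u2 ac; lia.
  case: (ltnP (pos x a) (pos x e)) => pe; first by apply: (red e b) => //; left.
  case: (boolP [&& key a < key (negT e), key (negT e) < key c & pos x a <= pos x (negT e)]); last first.
    move=> h; apply: (red e b) => //; right=> h1 h2; move: h.
    by rewrite h1 h2 /= -ltnNge.
  (* Here [-e] stands after the pair and is moved instead of [e]. If it is the witness [b], which is
     then down, the up value [e] takes over as witness. *)
  case/and3P=> n1 n2 n3; have pne : pos x a < pos x (negT e).
    rewrite ltn_neqAle n3 -eq_pos andbT; apply: contra ena => /eqP ->; by rewrite negTK.
  have nn1 : negT e != negT a by rewrite (inj_eq (inv_inj (@negTK n))).
  have nn2 : negT e != negT c by rewrite (inj_eq (inv_inj (@negTK n))) eq_key; mlia.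
  case: (eqVneq (negT e) b) => [E|nb]; last by apply: (red (negT e) b) => //; left.
  apply: (red (negT e) e) => //; [by rewrite eq_key; mlia| |by left].
  move: wb; rewrite -E /witness UN ltnNge n3 /=; case: (U e) => //= _.
  by rewrite ltn_neqAle pe -eq_pos ea.
move/existsPn=> none.
have out k : key a < k -> k < key c -> [\/ k = key b, k = key (negT a) | k = key (negT c)].
  move=> k1 k2; have [|e Ee] := @key_surj n k; first by have := key_lt c; mlia.
  have := none e; rewrite !eq_key Ee k1 k2 /=.
  case: (k =P key b) => [|_]; first by constructor.
  case: (k =P key (negT a)) => [|_]; first by constructor 2.
  by case: (k =P key (negT c)) => [|_]; first by constructor 3.
case: (leqP (key c) (key a).+2) => small.
  have Kb : key b = (key a).+1 by mlia.
  have Kc : key c = (key b).+1 by mlia.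
  case: (leqP n (key b)) => nb; first exact: (@base_simple x a c b).
  rewrite -refl_rev; apply: (@base_simple _ _ _ (negT b)); rewrite ?adj_neg //; try by mlia.
  by rewrite (witness_neg UN) // -(witness_adj U ad) // eq_key; mlia.
have l1 := out (key a).+1; have l2 := out (key a).+2; have l3 := out (key a).+3.
(* At most one of [-a] and [-c] lies between [a] and [c], and here one does. So the values from [a]
   to [c] are [-1, 1, 2, 3] with [b = 2], or [-3, -2, -1, 1] with [b = -2]. *)
have big : key c = (key a).+3 /\ ((key a).+1 = n /\ key b = n.+1 \/ (key a).+3 = n /\ (key b).+2 = n).
  clear - l1 l2 l3 small ab bc ka kb kc ac.
  have {}l1 : [\/ (key a).+1 = key b, (key a).+1 = key (negT a) | (key a).+1 = key (negT c)] by apply: l1; lia.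
  have {}l2 : [\/ (key a).+2 = key b, (key a).+2 = key (negT a) | (key a).+2 = key (negT c)] by apply: l2; lia.
  case: (ltngtP (key c) (key a).+3) => h; first by lia.
    have {}l3 : [\/ (key a).+3 = key b, (key a).+3 = key (negT a) | (key a).+3 = key (negT c)] by apply: l3; lia.
    by case: l1 => ?; case: l2 => ?; case: l3 => ?; lia.
  by split=> //; case: l1 => ?; case: l2 => ?; lia.
case: big => Kc Hab.
have bs : [&& b != a, b != c, b != negT a & b != negT c].
  by rewrite !eq_key; clear - Kc Hab ka kb kc; lia.
have [x' [sx' adn ad' same]] := move_center sx ad pa bs.
apply: (arc_transfer congR sx' sx ad' ad) => //.
  (* In [x] and in [x'] alike, [-a] and [-c] stand in the left half and [a] in the right half, so
     the sides agree. *)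
  move=> e e1 e2; case: (out (key e) e1 e2) => [/key_inj->//|/key_inj->|/key_inj->].
    by move/eqP: adn => ->; rewrite ltnSn; clear - pna pa; lia.
  have := pos_neg a sx'; have := pos_neg c sx'; move/eqP: adn; move/eqP: ad'; move/eqP: ad.
  by clear - pa pna pnc; lia.
have wb' : witness U x' a b by rewrite (witness_same same).
(* The middle of [x'] reads [-c -a a c]: in the first case [-a a c] gives a hexagon, in the second
   the whole window gives an octagon. *)
case: Hab => -[Ka Kb].
  apply: (@hexagon _ _ congR U x' (negT a) a c b) => //.
  - by apply: contra ca => /eqP ->; rewrite negTK.
  - by clear - Ka ka; lia.
  - by clear - Ka ka Kc; lia.
  - by case/and4P: bs.
  - by apply: IH; clear - Ka ka Kc; lia.
  by apply: IH; clear - Ka ka Kc; lia.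
have Ea : a = negT (negT a) by rewrite negTK.
rewrite Ea; apply: (@octagon_side _ _ congR U UN x' (negT a) c b); rewrite ?negTK //.
- by clear - kc Kc Ka; lia.
- by clear - kc Kc Ka ka; lia.
- by clear - kc Kc Ka Kb kb; lia.
have -> : c = negT (negT c) by rewrite negTK.
apply: contracted_neg => //; apply: IH; clear - kc Kc Ka ka; lia.
Qed.

Lemma contracted_all a c : contracted a c.
Proof.
have [m] := ubnP (key c - key a); elim: m a c => // m IH a c lem x sx ad ac.
case/existsP=> b /and3P[ab bc wb].
have IH' a' c' : key a <= key a' -> key c' <= key c -> key c' - key a' < key c - key a ->
    contracted a' c' by move=> _ _ h; apply: IH; apply: leq_trans h _; rewrite -ltnS.
case: (leqP n (pos x c)) => pc; first exact: (@contracted_half x a c b).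
(* The pair stands in the left half, so its mirror image stands in the right half. *)
rewrite -refl_rev; have ka := key_neg a; have kc := key_neg c; have kb := key_neg b.
apply: (@contracted_half x (negT c) (negT a) (negT b)); rewrite ?adj_neg ?ltn_key_neg //.
- by have := pos_neg a sx; move/eqP: ad; mlia.
- rewrite (witness_neg UN) // -(witness_adj U ad) // eq_key; mlia.
by move=> a' c' _ _ h; apply: IH; clear - h lem ka kc; lia.
Qed.

Lemma ceq_sub x y : ceq U x y -> R x y.
Proof.
elim=> [{}x sx|{}x a c sx ad ac ct|{}x {}y _|{}y {}x z _ h1 _].
- exact: cong_refl.
- exact: contracted_all.
- exact: cong_sym.
exact: cong_trans h1.
Qed.
End Generated.

Theorem theorem7p3 (n : nat) (up : nat -> bool) (x y : {perm sgn n}) :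
  signed x -> signed y ->
  (etaB up x = etaB up y <-> camb_cong up x y).
Proof.
move=> sx sy; rewrite etaP //; split=> [cxy R congR genR|]; first exact: ceq_sub cxy.
(* The relation [ceq] is itself a congruence containing the generators, so it contains the smallest
   one. *)
by apply; [exact: (ceq_cong (@upSN n up))|exact: arrow_ceq].
Qed.
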